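(* Let $\Sigma$ be a topologically mixing countable Markov shift and $f:\Sigma\to\mathbb{R}$ a summable Markov potential with $V_1(f)<\infty$ and $P_G(f)<\infty$. For $t>1$ let $\mu_{tf}$ be the unique equilibrium state of $tf$, and let $\mu_\infty$ be the weak limit of $\mu_{tf}$ as $t\to\infty$ (which exists and lies in $\mathcal{M}_{\max}(f)$). Then \[h(\mu_\infty)=\lim_{t\to\infty}h(\mu_{tf})=\sup_{\mu\in\mathcal{M}_{\max}(f)}h(\mu).\]
   Context: Let $M=(M_{ij})_{i,j\in\mathbb{N}}$ be a $0$-$1$ matrix and $\Sigma=\{x\in\mathbb{N}^{\mathbb{N}}: M_{x_ix_{i+1}}=1\ \forall i\ge0\}$ with the product topology and shift $\sigma$. Cylinders $[\omega]$ are sets of points beginning with the admissible word $\omega$. $\Sigma$ is topologically mixing if $\sigma$ is topologically mixing, i.e. for all symbols $i,j$ there is $N$ such that for every $n\ge N$ there is an admissible word of length $n$ starting with $i$ and ending with $j$. $V_1(f)=\sup\{|f(x)-f(y)|:x_0=y_0\}$. $f$ is a Markov potential if $f(x)$ depends only on $(x_0,x_1)$. $f$ is summable if $\sum_{i\in\mathbb{N}}\exp(\sup f|_{[i]})<\infty$. $P_G$ denotes Gurevich pressure, $P_G(f)=\lim_n\frac1n\log\sum_{\sigma^nx=x}\exp(\sum_{j<n}f(\sigma^jx))\mathbf{1}_{[a]}(x)$. $\mathcal{M}_\sigma(\Sigma)$ is the set of $\sigma$-invariant Borel probability measures with the weak (narrow) topology. An equilibrium state for $g$ is $\mu\in\mathcal{M}_\sigma(\Sigma)$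 with $\int g\,d\mu>-\infty$ and $h(\mu)+\int g\,d\mu=\sup\{h(\nu)+\int g\,d\nu:\int g\,d\nu>-\infty\}$, $h$ the Kolmogorov–Sinai entropy. $\beta=\sup\{\int f\,d\mu:\mu\in\mathcal{M}_\sigma(\Sigma)\}$ and $\mathcal{M}_{\max}(f)=\{\mu\in\mathcal{M}_\sigma(\Sigma):\int f\,d\mu=\beta\}$. *)

(* Defs.v *)
From HB Require Import structures.
From mathcomp Require Import all_boot all_order all_algebra.
From mathcomp Require Import all_classical all_reals all_analysis.
Set Implicit Arguments. Unset Strict Implicit. Unset Printing Implicit Defensive.
Import Order.TTheory GRing.Theory Num.Theory.
Import numFieldNormedType.Exports.
Local Open Scope classical_set_scope.
Local Open Scope ring_scope.

Definition cms_shift (x : nat -> nat) : nat -> nat := fun i => x i.+1.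

Definition cms_Sigma (M : nat -> nat -> bool) : set (nat -> nat) :=
  [set x | forall i, M (x i) (x i.+1)].

Definition cms_admissible_word (M : nat -> nat -> bool) (w : seq nat) : Prop :=
  forall k, (k.+1 < size w)%N -> M (nth 0%N w k) (nth 0%N w k.+1).

Definition cms_topologically_mixing (M : nat -> nat -> bool) : Prop :=
  forall i j : nat, exists N : nat, forall n : nat, (N <= n)%N ->
    exists w : seq nat, [/\ size w = n, cms_admissible_word M w,
      nth 0%N w 0 = i & nth 0%N w n.-1 = j].

(* cylinder sets [w_0 ... w_{n-1}] of N^N; they generate the Borel
   sigma-algebra of the product topology on N^N *)
Definition cms_cylinders : set (set (nat -> nat)) :=
  [set A | exists (n : nat) (w : nat -> nat),
     A = [set x | forall k, (k < n)%N -> x k = w k]].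

Definition cms_shiftSpace := g_sigma_algebraType cms_cylinders.

Section Defs.
Variable R : realType.
Variable M : nat -> nat -> bool.

Local Open Scope ereal_scope.

Definition cms_markov_potential (f : (nat -> nat) -> R) : Prop :=
  exists g : nat -> nat -> R, forall x, cms_Sigma M x -> f x = g (x 0%N) (x 1%N).

Definition cms_V1 (f : (nat -> nat) -> R) : \bar R :=
  ereal_sup [set r | exists x y, [/\ cms_Sigma M x, cms_Sigma M y, x 0%N = y 0%N &
     r = (`|f x - f y|)%:E]].

Definition cms_sup_cyl (f : (nat -> nat) -> R) (i : nat) : \bar R :=
  ereal_sup [set (f x)%:E | x in [set x | cms_Sigma M x /\ x 0%N = i]].

Definition cms_summable (f : (nat -> nat) -> R) : Prop :=
  \sum_(0 <= i <oo) expeR (cms_sup_cyl f i) < +oo.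

Definition cms_birkhoff (f : (nat -> nat) -> R) (n : nat) (x : nat -> nat) : R :=
  (\sum_(j < n) f (iter j cms_shift x))%R.

Definition cms_Zn (f : (nat -> nat) -> R) (n a : nat) : \bar R :=
  \esum_(x in [set x | [/\ cms_Sigma M x, iter n cms_shift x = x & x 0%N = a]])
     expeR (cms_birkhoff f n x)%:E.

(* Gurevich pressure (as a limsup; the limit exists for mixing shifts) *)
Definition cms_gurevich_pressure (f : (nat -> nat) -> R) (a : nat) : \bar R :=
  limn_esup (fun n : nat => ((n%:R)^-1)%:E * lne (cms_Zn f n a)).

Definition cms_invariant (mu : probability cms_shiftSpace R) : Prop :=
  mu (cms_Sigma M) = 1 /\
  forall A : set cms_shiftSpace, measurable A -> mu (cms_shift @^-1` A) = mu A.

Definition cms_integ (mu : probability cms_shiftSpace R) (g : (nat -> nat) -> R)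
  : \bar R := \int[mu]_(x in cms_Sigma M) (g x)%:E.

Definition cms_finite_partition (k : nat) (P : 'I_k -> set cms_shiftSpace) : Prop :=
  [/\ forall i, measurable (P i),
      forall i j, i != j -> P i `&` P j = set0 &
      \bigcup_(i in [set: 'I_k]) P i = setT].

Definition cms_join_atom (k n : nat) (P : 'I_k -> set cms_shiftSpace)
  (w : {ffun 'I_n -> 'I_k}) : set cms_shiftSpace :=
  [set x | forall i : 'I_n, P (w i) (iter i cms_shift x)].

Definition cms_etaH (p : R) : R := (- (p * ln p))%R.

Definition cms_part_entropy (mu : probability cms_shiftSpace R) (k n : nat)
  (P : 'I_k -> set cms_shiftSpace) : R :=
  (\sum_(w : {ffun 'I_n -> 'I_k}) cms_etaH (fine (mu (cms_join_atom P w))))%R.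

Definition cms_entropy_wrt (mu : probability cms_shiftSpace R) (k : nat)
  (P : 'I_k -> set cms_shiftSpace) : R :=
  limn (fun n : nat => (cms_part_entropy mu n P / n%:R)%R).

Definition cms_ks_entropy (mu : probability cms_shiftSpace R) : \bar R :=
  ereal_sup [set r | exists (k : nat) (P : 'I_k -> set cms_shiftSpace),
    cms_finite_partition P /\ r = (cms_entropy_wrt mu P)%:E].

Definition cms_equilibrium_state (g : (nat -> nat) -> R)
  (mu : probability cms_shiftSpace R) : Prop :=
  [/\ cms_invariant mu, cms_integ mu g > -oo &
   cms_ks_entropy mu + cms_integ mu g =
   ereal_sup [set cms_ks_entropy nu + cms_integ nu g | nu in
     [set nu | cms_invariant nu /\ cms_integ nu g > -oo]]].

Definition cms_beta_max (f : (nat -> nat) -> R) : \bar R :=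
  ereal_sup [set cms_integ nu f | nu in cms_invariant].

Definition cms_Mmax (f : (nat -> nat) -> R) : set (probability cms_shiftSpace R) :=
  [set mu | cms_invariant mu /\ cms_integ mu f = cms_beta_max f].

End Defs.

Definition cms_weak_cvg_pinfty (R : realType)
  (mus : R -> probability cms_shiftSpace R) (m : probability cms_shiftSpace R) : Prop :=
  forall phi : {ptws nat -> nat} -> R, continuous phi ->
    (exists C : R, forall x, `|phi x| <= C) ->
    (fun t : R => (\int[mus t]_x (phi x)%:E)%E) @ +oo%R -->
      (\int[m]_x (phi x)%:E)%E.

(* Main.v *)
Require Import Defs.
From HB Require Import structures.
From mathcomp Require Import all_boot all_order all_algebra.
From mathcomp Require Import all_classical all_reals all_analysis.
From mathcomp Require Import measurable_realfun ring lra.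
Import Order.TTheory GRing.Theory Num.Theory.
Import numFieldNormedType.Exports.
Local Open Scope classical_set_scope.
Local Open Scope ring_scope.

(** Up to the constant [C], the potential is [- u] with [u >= 0] and
    [\sum_a exp (- inf u|[a])] finite. Comparing the equilibrium states of
    different [t f] with each other and with any invariant [nu], [h (mu_t)]
    is nonincreasing in [t] and
    [\int u dmu_t <= \int u dnu + h (mu_2) / t]; hence the weak limit minimizes
    [\int u], and every maximizing measure has entropy at most [h (mu_t)].

    It remains to see that [h (mu_t)] is eventually at most [h (mu_inf) + e].
    For the partition [alpha_K] into [0], ..., [K-1] and the rest,
    [h (nu) <= H_nu (alpha_K^n) / n + \sum_(i >= K) - nu [i] ln (nu [i])], and
    Gibbs' inequality bounds the last sum by
    [\int_{x_0 >= K} u dnu + \sum_(i >= K) exp (- inf u|[i])]. As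
    [\int u dmu_t] converges to [\int u dmu_inf], the function [u] is uniformly
    integrable along [mu_t], so this is small uniformly in large [t], while
    [H_{mu_t} (alpha_K^n)] is continuous in [t] at infinity. *)

(** The obstacle is the lack of compactness: entropy need not be upper semicontinuous, because
    symbols far out, of small total mass, can carry entropy that a weak limit loses. The countable
    partition into cylinders of length one is never handled directly. Any finite partition is
    compared with words over [alpha_L], then [alpha_L] with [alpha_K], and [L] goes to infinity at
    fixed [K]. Atoms of the joins of [alpha_K] depend on finitely many coordinates, hence are clopen
    even when they involve infinitely many symbols, and their masses pass to the weak limit. The
    entropy of the remaining symbols is paid for by energy. Weak convergence alone gives only lower
    semicontinuity of [\int u], through the bounded truncations [min u N]; that no energy escapes
    comes from [mu_t] being almost minimizing. *)

(** * Inequalities and continuity for the function [- p ln p] *)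

Lemma etaH0 {R : realType} : cms_etaH (0 : R) = 0.
Proof. by rewrite /cms_etaH mul0r oppr0. Qed.

Lemma etaH1 {R : realType} : cms_etaH (1 : R) = 0.
Proof. by rewrite /cms_etaH ln1 mulr0 oppr0. Qed.

Lemma etaH_ge0 {R : realType} (p : R) : 0 <= p -> p <= 1 -> 0 <= cms_etaH p.
Proof. by move=> p0 p1; rewrite /cms_etaH -mulrN mulr_ge0// oppr_ge0 ln_le0. Qed.

Lemma etaHD {R : realType} (x y : R) : 0 <= x -> 0 <= y ->
  cms_etaH (x + y) <= cms_etaH x + cms_etaH y.
Proof.
rewrite le_eqVlt => /orP[/eqP<-|x0]; first by rewrite etaH0 !add0r.
rewrite le_eqVlt => /orP[/eqP<-|y0]; first by rewrite etaH0 !addr0.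
rewrite /cms_etaH mulrDl opprD lerD// lerN2 ler_pM2l// ler_ln ?posrE ?addr_gt0//.
  by rewrite lerDl ltW.
by rewrite lerDr ltW.
Qed.

Lemma etaH_sum {R : realType} (I : Type) (r : seq I) (P : pred I) (F : I -> R) :
  (forall i, 0 <= F i) ->
  cms_etaH (\sum_(i <- r | P i) F i) <= \sum_(i <- r | P i) cms_etaH (F i).
Proof.
move=> F0; elim: r => [|i r IH]; first by rewrite !big_nil etaH0.
rewrite !big_cons; case: (P i) => //.
by rewrite (le_trans (etaHD _ _ _ _))// ?sumr_ge0// lerD2l.
Qed.

(* [ln y <= y - 1] at [y = exp (- v) / p] *)
Lemma etaH_gibbs {R : realType} (p v : R) : 0 <= p ->
  cms_etaH p <= p * v + expR (- v).
Proof.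
rewrite le_eqVlt => /orP[/eqP<-|p0]; first by rewrite etaH0 mul0r add0r expR_ge0.
have q0 : 0 < expR (- v) / p by rewrite divr_gt0// expR_gt0.
have : ln (expR (- v) / p) <= expR (- v) / p - 1.
  rewrite -{1}(subrK 1 (expR (- v) / p)) (addrC _ 1) le_ln1Dx//.
  by rewrite ltrBrDl subrr.
rewrite ln_div ?posrE ?expR_gt0// expRK -(ler_pM2l p0) !mulrBr mulr1 mulrN.
rewrite mulrCA divff ?gt_eqF// mulr1 /cms_etaH; lra.
Qed.

(** With [s = sqrt p] the left side is [2 s^2 ln (1/s)], and [ln (1/s) < 1/s]. The bound serves to
    squeeze [cms_etaH] at [0]. *)
Lemma etaH_sqrt {R : realType} (p : R) : 0 <= p ->
  cms_etaH p <= 2 * Num.sqrt p.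
Proof.
rewrite le_eqVlt => /orP[/eqP<-|p0]; first by rewrite etaH0 sqrtr0 mulr0.
have s0 : 0 < Num.sqrt p by rewrite sqrtr_gt0.
have E : p = Num.sqrt p ^+ 2 by rewrite sqr_sqrtr ?ltW.
rewrite /cms_etaH; move: (Num.sqrt p) s0 E => s s0 ->.
have : ln s^-1 < s^-1 by rewrite ln_sublinear// invr_gt0.
rewrite lnV ?posrE// lnXn// mulr2n -mulrN opprD => h.
have -> : 2 * s = s ^+ 2 * (s^-1 + s^-1) by field; rewrite gt_eqF.
by rewrite ler_pM2l ?exprn_gt0// lerD// ltW.
Qed.

Lemma etaH_continuous {R : realType} (p : R) : 0 <= p ->
  {for p, continuous (@cms_etaH R)}.
Proof.
rewrite le_eqVlt => /orP[/eqP<-|p0]; last first.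
  rewrite /prop_for /continuous_at /cms_etaH.
  by apply: cvgN; apply: cvgM; [exact: cvg_id|exact: continuous_ln].
rewrite /prop_for /continuous_at etaH0.
apply: (@squeeze_cvgr _ _ _ _ (fun=> 0) (fun q : R => 2 * Num.sqrt `|q|)).
- near=> q.
  have q1 : `|q| <= 1 by near: q; exists 1 => //= y; rewrite /= sub0r normrN => /ltW.
  have [q0|q0] := leP 0 q.
    rewrite etaH_ge0 ?(le_trans (ler_norm q))//=.
    by rewrite ger0_norm// etaH_sqrt.
  (* [ln] is [0] on nonpositive reals, so [cms_etaH] vanishes to the left of [0] and the continuity
     there is two-sided. *)
  rewrite /cms_etaH ln0; last exact: ltW.
  by rewrite mulr0 oppr0 lexx/= mulr_ge0// sqrtr_ge0.
- exact: cvg_cst.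
- rewrite -[X in _ --> X](_ : 2 * Num.sqrt `|0 : R| = 0); last first.
    by rewrite normr0 sqrtr0 mulr0.
  apply: cvgM; first exact: cvg_cst.
  by apply: continuous_cvg; [exact: sqrt_continuous|exact: (@norm_continuous _ R^o)].
Unshelve. all: by end_near. Qed.

(** Nonnegativity of mutual information for a joint mass [q] of arbitrary total [z]. Each [q a b] is
    compared with the product of marginals [r a * s b / z] by [ln y <= y - 1]; the corrections
    [r a * s b / z - q a b] sum to zero. Leaving [q] unnormalized lets it be the slice of a joint
    law over one value of a third variable. *)
Lemma etaH_submodular {R : realType} (A B : finType) (q : A -> B -> R) :
  (forall a b, 0 <= q a b) ->
  \sum_a \sum_b cms_etaH (q a b) + cms_etaH (\sum_a \sum_b q a b) <=
  \sum_a cms_etaH (\sum_b q a b) + \sum_b cms_etaH (\sum_a q a b).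
Proof.
move=> q0.
pose r a := \sum_b q a b; pose s b := \sum_a q a b; pose z := \sum_a r a.
have r0 a : 0 <= r a by exact: sumr_ge0.
have s0 b : 0 <= s b by exact: sumr_ge0.
have zs : z = \sum_b s b by rewrite /z exchange_big.
have qr a b : q a b <= r a.
  by rewrite /r (bigD1 b)//= lerDl sumr_ge0.
have qs a b : q a b <= s b.
  by rewrite /s (bigD1 a)//= lerDl sumr_ge0.
have rz a : r a <= z by rewrite /z (bigD1 a)//= lerDl sumr_ge0.
have pt a b : cms_etaH (q a b) <= q a b * ln z - q a b * ln (r a) -
    q a b * ln (s b) + (r a * s b / z - q a b).
  have := q0 a b; rewrite le_eqVlt => /orP[/eqP<-|p0].
    rewrite etaH0 !mul0r !subr0 add0r divr_ge0 ?mulr_ge0//.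
    by rewrite (le_trans (r0 a)).
  have ra := lt_le_trans p0 (qr a b); have sb := lt_le_trans p0 (qs a b).
  have z0 := lt_le_trans ra (rz a).
  have y0 : 0 < r a * s b / z / q a b by rewrite !divr_gt0 ?mulr_gt0.
  have : ln (r a * s b / z / q a b) <= r a * s b / z / q a b - 1.
    rewrite -{1}(subrK 1 (r a * s b / z / q a b)) (addrC _ 1) le_ln1Dx//.
    by rewrite ltrBrDl subrr.
  rewrite !ln_div ?posrE ?divr_gt0 ?mulr_gt0// lnM ?posrE//.
  rewrite -(ler_pM2l p0) [X in _ <= X]mulrBr mulr1 [q a b * (_ / q a b)]mulrC.
  by rewrite divfK ?gt_eqF// /cms_etaH; lra.
have z_r : \sum_a \sum_b r a * s b / z = z.
  under eq_bigr do rewrite -mulr_suml -mulr_sumr -zs.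
  rewrite -mulr_suml -mulr_suml -/z.
  by have [->|z0] := eqVneq z 0; rewrite ?mul0r// mulfK.
have h1 : \sum_a \sum_b (q a b * ln z - q a b * ln (r a) -
    q a b * ln (s b) + (r a * s b / z - q a b)) =
    z * ln z + \sum_a cms_etaH (r a) + \sum_b cms_etaH (s b).
  under eq_bigr do rewrite !big_split/= !sumrN.
  rewrite !big_split/= !sumrN z_r -/z subrr addr0; congr (_ + _ + _).
  - by rewrite /z mulr_suml; apply: eq_bigr => a _; rewrite -mulr_suml.
  - by congr (- _); apply: eq_bigr => a _; rewrite -mulr_suml.
  - rewrite exchange_big/=; congr (- _); apply: eq_bigr => b _.
    by rewrite -mulr_suml.
have : \sum_a \sum_b cms_etaH (q a b) <= z * ln z + \sum_a cms_etaH (r a) +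
    \sum_b cms_etaH (s b).
  by rewrite -h1; apply: ler_sum => a _; apply: ler_sum.
rewrite [cms_etaH (\sum_a \sum_b q a b)]/cms_etaH -/z; lra.
Qed.

(** * Entropy of finite random variables *)

(** Stated on fibres, so that [T] needs no sigma-algebra; for finite [T] this is ordinary
    measurability. *)
Definition finite_rv {d} {Om : measurableType d} {T : Type} (X : Om -> T) :=
  forall a, measurable (X @^-1` [set a]).

Definition determines {Om S T : Type} (Y : Om -> S) (X : Om -> T) :=
  forall x y, Y x = Y y -> X x = X y.

Definition shannon {d} {Om : measurableType d} {R : realType}
  (mu : probability Om R) {T : finType} (X : Om -> T) : R :=
  \sum_a cms_etaH (fine (mu (X @^-1` [set a]))).

Lemma finite_rv_determined {d} {Om : measurableType d} {S : finType} {T : Type}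
  (Y : Om -> S) (X : Om -> T) :
  finite_rv Y -> determines Y X -> finite_rv X.
Proof.
move=> mY YX a.
rewrite [X in measurable X](_ : _ =
    \bigcup_(b in [set b | exists2 x, Y x = b & X x = a]) (Y @^-1` [set b])).
  by apply: fin_bigcup_measurable => [|b _]; [exact: finite_finset|exact: mY].
apply/seteqP; split => [x /= Xx|x [b [y Yy Xy]] /= Yx].
  by exists (Y x) => //; exists x.
by rewrite -Xy; apply: YX; rewrite Yx.
Qed.

Lemma finite_rv_pair {d} {Om : measurableType d} {S T : Type}
  (X : Om -> S) (Y : Om -> T) :
  finite_rv X -> finite_rv Y -> finite_rv (fun x => (X x, Y x)).
Proof.
move=> mX mY [a b].
rewrite [X in measurable X](_ : _ = X @^-1` [set a] `&` Y @^-1` [set b]).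
  exact: measurableI.
by apply/seteqP; split => x /= [-> ->].
Qed.

Lemma fine_probability_bounds {d} {Om : measurableType d} {R : realType}
  (mu : probability Om R) (A : set Om) : measurable A -> 0 <= fine (mu A) <= 1.
Proof.
move=> mA; rewrite fine_ge0 ?measure_ge0//=.
by rewrite -lee_fin fineK ?fin_num_measure// probability_le1.
Qed.

Lemma fine_probability_fibers {d} {Om : measurableType d} {R : realType}
  (mu : probability Om R) {T : finType} (Y : Om -> T) (A : set Om) :
  measurable A -> finite_rv Y ->
  fine (mu A) = \sum_b fine (mu (A `&` Y @^-1` [set b])).
Proof.
move=> mA mY.
have mB b : measurable (A `&` Y @^-1` [set b]) by exact: measurableI.
have {1}-> : A = \bigcup_(b in [set: T]) (A `&` Y @^-1` [set b]).
  apply/seteqP; split => [x Ax|x [b _ []]//].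
  by exists (Y x).
rewrite measure_fin_bigcup//; [|exact: finite_finset|]; last first.
  by move=> b c _ _ [x [[_ <-] [_ <-]]].
rewrite (fsbigE (index_enum T)) ?index_enum_uniq//; last first.
  by move=> b _; rewrite mem_index_enum.
rewrite -sum_fine => [|b _]; last by rewrite fin_num_measure.
by apply: eq_bigl => b; rewrite in_setT.
Qed.

Lemma shannon_ge0 {d} {Om : measurableType d} {R : realType}
  (mu : probability Om R) {T : finType} (X : Om -> T) :
  finite_rv X -> 0 <= shannon mu X.
Proof.
move=> mX; apply: sumr_ge0 => a _.
by have /andP[] := fine_probability_bounds mu _ (mX a); exact: etaH_ge0.
Qed.

Lemma shannon_cst {d} {Om : measurableType d} {R : realType}
  (mu : probability Om R) {T : finType} (X : Om -> T) :
  (forall x y, X x = X y) -> shannon mu X = 0.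
Proof.
move=> cX; rewrite /shannon big1// => a _.
have [[x Xx]|nX] := pselect (exists x, X x = a).
  rewrite [X in mu X](_ : _ = setT) ?probability_setT ?etaH1//.
  by apply/seteqP; split => y //= _; rewrite -Xx.
rewrite [X in mu X](_ : _ = set0) ?measure0 ?etaH0//.
by apply/seteqP; split => y //= Xy; apply: nX; exists y.
Qed.

(** Subadditivity of [cms_etaH] splits every fibre of [X] along the fibres of [Y], and a fibre of
    [Y] meets only one fibre of [X]. *)
Lemma shannon_le {d} {Om : measurableType d} {R : realType}
  (mu : probability Om R) {S T : finType} (Y : Om -> S) (X : Om -> T) :
  finite_rv Y -> determines Y X -> shannon mu X <= shannon mu Y.
Proof.
move=> mY YX; have mX := finite_rv_determined _ _ mY YX.
rewrite /shannon; under eq_bigr => a _ do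
  rewrite (fine_probability_fibers mu Y _ (mX a) mY).
apply: (@le_trans _ _ (\sum_a \sum_b
    cms_etaH (fine (mu (X @^-1` [set a] `&` Y @^-1` [set b]))))).
  apply: ler_sum => a _; apply: etaH_sum => b.
  by rewrite fine_ge0.
rewrite exchange_big/=; apply: ler_sum => b _.
have [[x Yx]|nY] := pselect (exists x, Y x = b); last first.
  have Y0 : Y @^-1` [set b] = set0.
    by apply/seteqP; split => y //= Yy; apply: nY; exists y.
  by rewrite Y0 measure0 etaH0 big1// => a _; rewrite setI0 measure0 etaH0.
rewrite (bigD1 (X x))//= big1 ?addr0 => [|a ax].
  rewrite setIidr//.
  by move=> y /= Yy; apply: YX; rewrite Yx.
rewrite [X in mu X](_ : _ = set0) ?measure0 ?etaH0//.
apply/seteqP; split => y //= [Xy Yy].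
by move/eqP: ax; apply; rewrite -Xy; apply: YX; rewrite Yx.
Qed.

(** Entropy depends only on the generated partition; this is used below to reshape tuples and
    itineraries. *)
Lemma shannon_eq {d} {Om : measurableType d} {R : realType}
  (mu : probability Om R) {S T : finType} (Y : Om -> S) (X : Om -> T) :
  finite_rv Y -> determines Y X -> determines X Y -> shannon mu X = shannon mu Y.
Proof.
move=> mY YX XY; apply/le_anti; rewrite !shannon_le//.
exact: finite_rv_determined mY YX.
Qed.

(** [etaH_submodular] on each slice [Z = c], summed over [c]. Subadditivity, monotonicity in the
    conditioning and concavity of itinerary entropies are all instances of this inequality. *)
Lemma shannon_submodular {d} {Om : measurableType d} {R : realType}
  (mu : probability Om R) {S T U : finType}
  (X : Om -> S) (Y : Om -> T) (Z : Om -> U) :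
  finite_rv X -> finite_rv Y -> finite_rv Z ->
  shannon mu (fun x => (X x, Y x, Z x)) + shannon mu Z <=
  shannon mu (fun x => (X x, Z x)) + shannon mu (fun x => (Y x, Z x)).
Proof.
move=> mX mY mZ.
pose q c a b := fine (mu ((fun x => (X x, Y x, Z x)) @^-1` [set (a, b, c)])).
have mXYZ : finite_rv (fun x => (X x, Y x, Z x)).
  by apply: finite_rv_pair => //; exact: finite_rv_pair.
have hXYZ : shannon mu (fun x => (X x, Y x, Z x)) =
    \sum_c \sum_a \sum_b cms_etaH (q c a b).
  rewrite exchange_big/=; under eq_bigr do rewrite exchange_big/=.
  by rewrite pair_bigA pair_bigA; apply: eq_bigr => -[[a b] c].
have hXZ : shannon mu (fun x => (X x, Z x)) =
    \sum_c \sum_a cms_etaH (\sum_b q c a b).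
  rewrite exchange_big/= pair_bigA; apply: eq_bigr => -[a c] _ /=.
  congr cms_etaH; rewrite (fine_probability_fibers mu Y)//; last exact: finite_rv_pair.
  apply: eq_bigr => b _; congr (fine (mu _)).
  by apply/seteqP; split => x /= => [[[-> ->] ->]|[-> -> ->]].
have hYZ : shannon mu (fun x => (Y x, Z x)) =
    \sum_c \sum_b cms_etaH (\sum_a q c a b).
  rewrite exchange_big/= pair_bigA; apply: eq_bigr => -[b c] _ /=.
  congr cms_etaH; rewrite (fine_probability_fibers mu X)//; last exact: finite_rv_pair.
  apply: eq_bigr => a _; congr (fine (mu _)).
  by apply/seteqP; split => x /= => [[[-> ->] ->]|[-> -> ->]].
have hZ : shannon mu Z = \sum_c cms_etaH (\sum_a \sum_b q c a b).
  apply: eq_bigr => c _ /=; congr cms_etaH.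
  rewrite (fine_probability_fibers mu (fun x => (X x, Y x)))//; last exact: finite_rv_pair.
  rewrite pair_bigA; apply: eq_bigr => -[a b] _; congr (fine (mu _)).
  by apply/seteqP; split => x /= => [[-> [-> ->]]|[-> -> ->]].
rewrite hXYZ hXZ hYZ hZ -!big_split/=; apply: ler_sum => c _.
by apply: etaH_submodular => a b; rewrite fine_ge0.
Qed.

Lemma shannon_subadditive {d} {Om : measurableType d} {R : realType}
  (mu : probability Om R) {S T : finType} (X : Om -> S) (Y : Om -> T) :
  finite_rv X -> finite_rv Y ->
  shannon mu (fun x => (X x, Y x)) <= shannon mu X + shannon mu Y.
Proof.
move=> mX mY.
have mU : finite_rv (fun _ : Om => tt).
  by apply: finite_rv_determined mX _.
have := shannon_submodular mu X Y (fun=> tt) mX mY mU.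
rewrite (shannon_cst mu (fun=> tt))// addr0.
have -> : shannon mu (fun x => (X x, Y x, tt)) = shannon mu (fun x => (X x, Y x)).
  by apply: shannon_eq; [exact: finite_rv_pair|move=> x y []-> ->|move=> x y []-> ->].
have -> : shannon mu (fun x => (X x, tt)) = shannon mu X.
  by apply: shannon_eq => // [x y ->|x y []].
have -> // : shannon mu (fun x => (Y x, tt)) = shannon mu Y.
by apply: shannon_eq => // [x y ->|x y []].
Qed.

Definition cond_shannon {d} {Om : measurableType d} {R : realType}
  (mu : probability Om R) {S T : finType} (X : Om -> S) (Z : Om -> T) : R :=
  shannon mu (fun x => (X x, Z x)) - shannon mu Z.

Lemma cond_shannon_le {d} {Om : measurableType d} {R : realType}
  (mu : probability Om R) {S T U : finType}
  (X : Om -> S) (Z : Om -> T) (W : Om -> U) :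
  finite_rv X -> finite_rv Z -> determines Z W ->
  cond_shannon mu X Z <= cond_shannon mu X W.
Proof.
move=> mX mZ ZW; have mW := finite_rv_determined _ _ mZ ZW.
have := shannon_submodular mu X Z W mX mZ mW.
have -> : shannon mu (fun x => (X x, Z x, W x)) = shannon mu (fun x => (X x, Z x)).
  apply: shannon_eq => [|x y [-> Zxy]|x y []-> -> //]; first exact: finite_rv_pair.
  by rewrite Zxy (ZW _ _ Zxy).
have -> : shannon mu (fun x => (Z x, W x)) = shannon mu Z.
  by apply: shannon_eq => // [x y Zxy|x y [] //]; rewrite Zxy (ZW _ _ Zxy).
rewrite /cond_shannon; lra.
Qed.

(** * Entropy rates of invariant measures *)

(** Its fibres are the atoms of the join of the partitions by [X \o iter i s], [i < n]. *)
Definition itinerary {Om T : Type} (s : Om -> Om) (X : Om -> T) (n : nat) (x : Om) :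
  {ffun 'I_n -> T} := [ffun i : 'I_n => X (iter i s x)].

Lemma itineraryP {Om T : Type} (s : Om -> Om) (X : Om -> T) (n : nat) (x y : Om) :
  (itinerary s X n x = itinerary s X n y) <->
  (forall i, (i < n)%N -> X (iter i s x) = X (iter i s y)).
Proof.
split=> [/ffunP h i ni|h]; first by have := h (Ordinal ni); rewrite !ffunE.
by apply/ffunP => i; rewrite !ffunE h.
Qed.

Lemma itinerary_determines {Om T : Type} (s : Om -> Om) (X : Om -> T) (n i : nat) :
  (i < n)%N -> determines (itinerary s X n) (X \o iter i s).
Proof. by move=> ni x y /itineraryP; exact. Qed.

Section invariant_measure.
Context {d} {Om : measurableType d} {R : realType} (mu : probability Om R)
  (s : Om -> Om).
Context (s_measurable : forall A, measurable A -> measurable (s @^-1` A))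
  (s_invariant : forall A, measurable A -> mu (s @^-1` A) = mu A).

Lemma finite_rv_iter {T : Type} (X : Om -> T) k :
  finite_rv X -> finite_rv (X \o iter k s).
Proof.
move=> mX; elim: k => [//|k IH] a.
rewrite (_ : X \o iter k.+1 s = (X \o iter k s) \o s); first exact: (s_measurable _ (IH a)).
by apply/funext => x /=; rewrite -iterSr.
Qed.

Lemma finite_rv_itinerary {T : finType} (X : Om -> T) n :
  finite_rv X -> finite_rv (itinerary s X n).
Proof.
move=> mX w.
rewrite [X in measurable X](_ : _ =
    \bigcap_(i in [set: 'I_n]) ((X \o iter i s) @^-1` [set w i])).
  by apply: fin_bigcap_measurable => // i _; exact: finite_rv_iter.
apply/seteqP; split => x /= => [<- i _/=|h]; first by rewrite ffunE.
by apply/ffunP => i; rewrite ffunE; exact: (h i I).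
Qed.

Lemma shannon_shift {T : finType} (X : Om -> T) :
  finite_rv X -> shannon mu (X \o s) = shannon mu X.
Proof.
move=> mX; apply: eq_bigr => a _.
by rewrite -[(X \o s) @^-1` _]/(s @^-1` (X @^-1` [set a])) s_invariant.
Qed.

Lemma shannon_iter {T : finType} (X : Om -> T) k :
  finite_rv X -> shannon mu (X \o iter k s) = shannon mu X.
Proof.
move=> mX; elim: k => [//|k <-].
rewrite (_ : X \o iter k.+1 s = (X \o iter k s) \o s).
  exact/shannon_shift/finite_rv_iter.
by apply/funext => x /=; rewrite -iterSr.
Qed.

Lemma cond_shannon_iter {S T : finType} (X : Om -> S) (Z : Om -> T) k :
  finite_rv X -> finite_rv Z ->
  cond_shannon mu (X \o iter k s) (Z \o iter k s) = cond_shannon mu X Z.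
Proof.
move=> mX mZ; rewrite /cond_shannon shannon_iter//; congr (_ - _).
exact: (shannon_iter (fun x => (X x, Z x)) k (finite_rv_pair _ _ mX mZ)).
Qed.

Lemma shannon_itinerary0 {T : finType} (X : Om -> T) :
  shannon mu (itinerary s X 0) = 0.
Proof. by apply: shannon_cst => x y; apply/itineraryP. Qed.

(** Submodularity for time [0], time [n + 1] and the block of times [1] to [n] between them;
    invariance then shifts the blocks back to start at [0]. *)
Lemma shannon_itinerary_concave {T : finType} (X : Om -> T) n : finite_rv X ->
  shannon mu (itinerary s X n.+2) + shannon mu (itinerary s X n) <=
  shannon mu (itinerary s X n.+1) + shannon mu (itinerary s X n.+1).
Proof.
move=> mX.
have mI k := finite_rv_itinerary X k mX.
have mIs k : finite_rv (itinerary s X k \o s) := finite_rv_iter _ 1 (mI k).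
have := shannon_submodular mu X (X \o iter n.+1 s) (itinerary s X n \o s) mX
  (finite_rv_iter _ _ mX) (mIs n).
rewrite (shannon_shift _ (mI n)).
rewrite -(shannon_eq mu (fun x => (X x, (X \o iter n.+1 s) x,
  (itinerary s X n \o s) x)) (itinerary s X n.+2) _); last 3 first.
- exact: finite_rv_pair (finite_rv_pair _ _ mX (finite_rv_iter X n.+1 mX)) (mIs n).
- move=> x y [X0 Xn /itineraryP h]; apply/itineraryP => -[//|i].
  rewrite ltnS ltnS leq_eqVlt => /orP[/eqP->//|/h].
  by rewrite /= -!iterSr.
- move=> x y /itineraryP h; congr (_, _, _); [exact: (h 0%N)|exact: (h n.+1)|].
  by apply/itineraryP => i ni; have := h i.+1 (ltnW ni); rewrite -!iterSr.
rewrite -(shannon_eq mu (fun x => (X x, (itinerary s X n \o s) x))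
  (itinerary s X n.+1) _); last 3 first.
- exact: finite_rv_pair mX (mIs n).
- move=> x y [X0 /itineraryP h]; apply/itineraryP => -[//|i].
  by rewrite ltnS => /h; rewrite -!iterSr.
- move=> x y /itineraryP h; congr (_, _); first exact: (h 0%N).
  by apply/itineraryP => i ni; have := h i.+1 ni; rewrite -!iterSr.
rewrite -(shannon_eq mu (fun x => ((X \o iter n.+1 s) x, (itinerary s X n \o s) x))
  (itinerary s X n.+1 \o s) _); last 3 first.
- exact: finite_rv_pair (finite_rv_iter X n.+1 mX) (mIs n).
- move=> x y [Xn /itineraryP h]; apply/itineraryP => i.
  rewrite ltnS leq_eqVlt => /orP[/eqP->|/h//].
  by rewrite -!iterSr.
- move=> x y /itineraryP h; congr (_, _).
    by have := h n (leqnn _); rewrite -!iterSr.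
  by apply/itineraryP => i ni; apply: h; exact: ltnW.
by rewrite (shannon_shift _ (mI n.+1)).
Qed.

(* The itinerary entropies are concave in [n] and vanish at [0]; this monotonicity
   replaces Fekete's lemma in the convergence of the rate. *)
Lemma shannon_itinerary_ratio {T : finType} (X : Om -> T) n : finite_rv X ->
  shannon mu (itinerary s X n.+2) / n.+2%:R <= shannon mu (itinerary s X n.+1) / n.+1%:R.
Proof.
move=> mX; pose a k := shannon mu (itinerary s X k).
(* By concavity the latest increment is at most each of the [k] earlier ones, which add up to
   [a k]. *)
have dn k : k%:R * (a k.+1 - a k) <= a k.
  elim: k => [|k IH]; first by rewrite mul0r /a shannon_itinerary0.
  have := shannon_itinerary_concave X k mX; rewrite -/(a _) -/(a _) -/(a _) => h.
  have : k.+1%:R * (a k.+2 - a k.+1) <= k.+1%:R * (a k.+1 - a k).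
    by rewrite ler_wpM2l// -/(a _); lra.
  have -> : k.+1%:R * (a k.+1 - a k) = k%:R * (a k.+1 - a k) + (a k.+1 - a k).
    by rewrite -natr1 mulrDl mul1r.
  move=> h'; apply: le_trans h' _; lra.
rewrite ler_pdivrMr// mulrAC ler_pdivlMr//.
have := dn n.+1; rewrite -/(a _) -/(a _) -(natr1 n.+1); lra.
Qed.

Definition entropy_rate {T : finType} (X : Om -> T) : R :=
  limn (fun n => shannon mu (itinerary s X n) / n%:R).

Lemma cvg_entropy_rate {T : finType} (X : Om -> T) : finite_rv X ->
  (fun n => shannon mu (itinerary s X n) / n%:R) @ \oo --> entropy_rate X.
Proof.
move=> mX; pose u n := shannon mu (itinerary s X n) / n%:R.
(* The quotient at [n = 0] is [0] by convention and would spoil monotonicity, hence the shift of the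
   index. *)
suff /cvg_ex[l] : cvgn [sequence u n.+1]_n.
  by rewrite /sequence cvg_shiftS => ul; exact: cvgP ul.
apply: nonincreasing_is_cvgn.
  by apply/nonincreasing_seqP => n; exact: shannon_itinerary_ratio.
exists 0 => _ [n _ <-] /=; rewrite divr_ge0//.
exact/shannon_ge0/finite_rv_itinerary.
Qed.

(** The monotone limit is an infimum. At fixed [n] the right side involves finitely many events, so
    it can follow a weak limit where the rate itself cannot. *)
Lemma entropy_rate_le {T : finType} (X : Om -> T) n : finite_rv X ->
  entropy_rate X <= shannon mu (itinerary s X n.+1) / n.+1%:R.
Proof.
move=> mX; apply: cvgr_to_le (cvg_entropy_rate X mX) _.
exists n.+1 => // -[//|m] /= nm; rewrite -(subnKC nm).
elim: (m.+1 - n.+1)%N => [|k IH]; first by rewrite addn0.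
apply: le_trans IH; rewrite addnS addSn.
exact: shannon_itinerary_ratio.
Qed.

Lemma entropy_rate_ge0 {T : finType} (X : Om -> T) : finite_rv X -> 0 <= entropy_rate X.
Proof.
move=> mX; apply: cvgr_to_ge (cvg_entropy_rate X mX) _.
by near=> n; rewrite divr_ge0//; apply/shannon_ge0/finite_rv_itinerary.
Unshelve. all: by end_near. Qed.

Lemma shannon_itineraryD {T : finType} (X : Om -> T) n m : finite_rv X ->
  shannon mu (itinerary s X (n + m)) <=
  shannon mu (itinerary s X n) + shannon mu (itinerary s X m).
Proof.
move=> mX.
have mIs : finite_rv (itinerary s X m \o iter n s).
  exact/finite_rv_iter/finite_rv_itinerary.
rewrite -(shannon_iter _ n (finite_rv_itinerary X m mX)).
apply: le_trans (shannon_subadditive mu _ _ (finite_rv_itinerary X n mX) mIs).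
apply: shannon_le; first exact: finite_rv_pair (finite_rv_itinerary X n mX) mIs.
move=> x y [/itineraryP h1 /itineraryP h2]; apply/itineraryP => i inm.
have [/h1//|ni] := ltnP i n.
have := h2 (i - n)%N; rewrite -!iterD subnK//; apply.
by rewrite ltn_subLR.
Qed.

(** The coordinates of the [X]-word are adjoined to the [Z]-word one by one. The one at time [k]
    costs at most its entropy given [Z] at time [k], which by invariance is the same for all [k]. *)
Lemma shannon_itinerary_cond {S T : finType} (X : Om -> S) (Z : Om -> T) n :
  finite_rv X -> finite_rv Z ->
  shannon mu (itinerary s X n) <=
  shannon mu (itinerary s Z n) + n%:R * cond_shannon mu X Z.
Proof.
move=> mX mZ.
have mIX k := finite_rv_itinerary X k mX; have mIZ k := finite_rv_itinerary Z k mZ.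
apply: (@le_trans _ _ (shannon mu (fun x => (itinerary s X n x, itinerary s Z n x)))).
  by apply: shannon_le; [exact: finite_rv_pair (mIX n) (mIZ n)|move=> x y []].
have : forall k, (k <= n)%N ->
    shannon mu (fun x => (itinerary s X k x, itinerary s Z n x)) <=
    shannon mu (itinerary s Z n) + k%:R * cond_shannon mu X Z; last exact.
elim=> [_|k IH kn].
  rewrite mul0r addr0; apply: (shannon_le mu _ _ (mIZ n)) => x y ->; congr (_, _).
  exact/itineraryP.
have mXk := finite_rv_iter X k mX; have mZk := finite_rv_iter Z k mZ.
have := shannon_submodular mu _ _ _ (mIX k) mXk (mIZ n).
rewrite -(shannon_eq mu
    (fun x => (itinerary s X k x, (X \o iter k s) x, itinerary s Z n x))
    (fun x => (itinerary s X k.+1 x, itinerary s Z n x)));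
    last 3 first.
- exact: finite_rv_pair (finite_rv_pair _ _ (mIX k) mXk) (mIZ n).
- move=> x y [/itineraryP h1 h2 h3]; rewrite h3; congr (_, _).
  by apply/itineraryP => i; rewrite ltnS leq_eqVlt => /orP[/eqP->|/h1].
- move=> x y [/itineraryP h1 ->]; congr (_, _, _); last exact: h1.
  by apply/itineraryP => i ik; apply: h1; exact: ltnW.
have := cond_shannon_le mu _ _ _ mXk (mIZ n) (itinerary_determines s Z n k kn).
rewrite cond_shannon_iter// {1}/cond_shannon => h1 h2.
have := IH (ltnW kn); rewrite -natr1 mulrDl mul1r.
move: h1 h2; rewrite /comp/=; lra.
Qed.

(** The previous bound with [Z] replaced by its words of length [m]. An itinerary of such words is
    determined by a [Z]-word longer by [m], and this excess costs a bounded amount, negligible after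
    division by [n]. *)
Lemma entropy_rate_cond {S T : finType} (X : Om -> S) (Z : Om -> T) m :
  finite_rv X -> finite_rv Z ->
  entropy_rate X <= entropy_rate Z + cond_shannon mu X (itinerary s Z m).
Proof.
move=> mX mZ; set c := cond_shannon _ _ _.
have mIZ k := finite_rv_itinerary Z k mZ.
pose b n := shannon mu (itinerary s Z n) / n%:R + shannon mu (itinerary s Z m) / n%:R + c.
have cb : b @ \oo --> entropy_rate Z + shannon mu (itinerary s Z m) * 0 + c.
  apply: cvgD; last exact: cvg_cst.
  apply: cvgD; first exact: cvg_entropy_rate.
  apply: cvgM; first exact: cvg_cst.
  rewrite -cvg_shiftS; exact: cvg_harmonic.
rewrite mulr0 addr0 in cb; apply: cvgr_to_ge cb _.
exists 1%N => // -[//|n] _ /=.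
apply: le_trans (entropy_rate_le X n mX) _.
rewrite /b -mulrDl -[c](mulfK (_ : n.+1%:R != 0)) ?pnatr_eq0// -mulrDl.
rewrite ler_pM2r ?invr_gt0//.
apply: le_trans (shannon_itinerary_cond X _ n.+1 mX (mIZ m)) _.
rewrite mulrC lerD2r -/c.
apply: le_trans (shannon_itineraryD Z n.+1 m mZ).
apply: (shannon_le mu _ _ (mIZ (n.+1 + m)%N)).
move=> x y /itineraryP h; apply/itineraryP => i ni; apply/itineraryP => j jm.
rewrite -!iterD; apply: h.
by rewrite addnC -addnS leq_add// ltnW.
Unshelve. all: by end_near. Qed.

End invariant_measure.

(** * Approximation by cylinder events *)

Lemma iter_cms_shift (k i : nat) (x : nat -> nat) :
  iter k cms_shift x i = x (i + k)%N.
Proof. by elim: k i => [|k IH] i /=; rewrite ?addn0// /cms_shift IH addSnnS. Qed.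

(** Such sets are clopen in the product topology but need not be finite unions of cylinders. *)
Definition finite_dim (n : nat) (A : set (nat -> nat)) :=
  forall x y : nat -> nat, (forall k, (k < n)%N -> x k = y k) -> A x -> A y.

Lemma finite_dim_measurable (n : nat) (A : set cms_shiftSpace) :
  finite_dim n A -> measurable A.
Proof.
(* Finite words are countably many, and [nth 0] extends a word by zeros to a point that decides
   whether its cylinder lies in [A]. *)
move=> nA; pose B (w : seq nat) : set cms_shiftSpace :=
  [set x | A (nth 0%N w) /\ forall k, (k < n)%N -> x k = nth 0%N w k].
have -> : A = \bigcup_(w in [set: seq nat]) B w.
  apply/seteqP; split => [x Ax|x [w _ [Aw xw]]].
    exists (mkseq x n) => //; split => [|k kn]; last by rewrite nth_mkseq.
    by apply: nA Ax => k kn; rewrite nth_mkseq.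
  by apply: nA Aw => k kn; rewrite xw.
apply: countable_bigcupT_measurable => // w.
have [Aw|nAw] := pselect (A (nth 0%N w)); last first.
  by rewrite (_ : B w = set0)//; apply/seteqP; split => x // [].
rewrite (_ : B w = [set x | forall k, (k < n)%N -> x k = nth 0%N w k]); last first.
  by apply/seteqP; split => x // [].
by apply: sub_sigma_algebra; exists n, (nth 0%N w).
Qed.

Lemma measurable_cms_shift (A : set cms_shiftSpace) :
  measurable A -> measurable (cms_shift @^-1` A : set cms_shiftSpace).
Proof.
move=> mA.
have : measurable_fun setT (cms_shift : cms_shiftSpace -> cms_shiftSpace).
  apply: (@measurability _ _ cms_shiftSpace cms_shiftSpace setT cms_shift cms_cylinders) => //.
  move=> _ [_ [n [w ->]] <-]; rewrite setTI.
  apply: (@finite_dim_measurable n.+1) => x y xy /= h k kn.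
  by rewrite -h// /cms_shift xy.
by move=> /(_ measurableT _ mA); rewrite setTI.
Qed.

(* The finite partition of the full shift into [0], ..., [K-1] and the union of
   all the other cylinders of length one. *)
Definition symbol_upto (K : nat) (x : cms_shiftSpace) : 'I_K.+1 := inord (minn (x 0%N) K).

Lemma symbol_uptoE (K : nat) (x : cms_shiftSpace) :
  symbol_upto K x = minn (x 0%N) K :> nat.
Proof. by rewrite inordK// ltnS geq_minr. Qed.

Lemma symbol_upto_eq (K : nat) (x y : cms_shiftSpace) :
  (symbol_upto K x = symbol_upto K y) <-> (minn (x 0%N) K = minn (y 0%N) K).
Proof.
split=> [/(congr1 val)/=|h]; first by rewrite !symbol_uptoE.
by apply/val_inj; rewrite /= !symbol_uptoE.
Qed.

Lemma symbol_upto_determines (K L : nat) : (K <= L)%N ->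
  determines (symbol_upto L) (symbol_upto K).
Proof.
move=> KL x y /symbol_upto_eq h; apply/symbol_upto_eq.
by rewrite -(minn_idPr KL) !minnA h.
Qed.

Lemma finite_rv_symbol_upto (K : nat) : finite_rv (symbol_upto K).
Proof.
move=> a; apply: (@finite_dim_measurable 1) => x y xy /= <-.
by apply/symbol_upto_eq; rewrite xy.
Qed.

(** A single parameter bounds both length and alphabet: the finite partitions refine as [L] grows,
    and together they generate the sigma-algebra. *)
Definition word_upto (L : nat) : cms_shiftSpace -> {ffun 'I_L -> 'I_L.+1} :=
  itinerary cms_shift (symbol_upto L) L.

Lemma word_upto_eq (L : nat) (x y : cms_shiftSpace) :
  (word_upto L x = word_upto L y) <->
  (forall i, (i < L)%N -> minn (x i) L = minn (y i) L).
Proof.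
rewrite itineraryP; split => h i iL; have := h i iL.
  by rewrite symbol_upto_eq !iter_cms_shift.
by rewrite symbol_upto_eq !iter_cms_shift.
Qed.

Lemma finite_rv_word_upto (L : nat) : finite_rv (word_upto L).
Proof.
by apply: finite_rv_itinerary; [exact: measurable_cms_shift|exact: finite_rv_symbol_upto].
Qed.

Lemma word_upto_determines (K L : nat) : (K <= L)%N ->
  determines (word_upto L) (word_upto K).
Proof.
move=> KL x y /word_upto_eq h; apply/word_upto_eq => i iK.
by rewrite -(minn_idPr KL) !minnA h// (leq_trans iK).
Qed.

Definition word_upto_saturated (L : nat) (C : set cms_shiftSpace) :=
  forall x y, word_upto L x = word_upto L y -> C x -> C y.

Lemma word_upto_saturatedW (K L : nat) (C : set cms_shiftSpace) : (K <= L)%N ->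
  word_upto_saturated K C -> word_upto_saturated L C.
Proof. by move=> KL CK x y /(word_upto_determines _ _ KL); exact: CK. Qed.

Lemma word_upto_saturated_measurable (L : nat) (C : set cms_shiftSpace) :
  word_upto_saturated L C -> measurable C.
Proof.
move=> CL; apply: (@finite_dim_measurable L) => x y xy; apply: CL.
by apply/word_upto_eq => i iL; rewrite xy.
Qed.

Section approximation.
Context {R : realType} (mu : probability cms_shiftSpace R).

Definition approximable (A : set cms_shiftSpace) :=
  measurable A /\ forall e : R, 0 < e ->
    exists L C, word_upto_saturated L C /\ (mu ((A `\` C) `|` (C `\` A)) < e%:E)%E.

Lemma approximableU (A B : set cms_shiftSpace) :
  approximable A -> approximable B -> approximable (A `|` B).
Proof.
move=> [mA hA] [mB hB]; split; first exact: measurableU.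
move=> e e0; have e2 : 0 < e / 2 by rewrite divr_gt0.
have [L [C [LC muC]]] := hA _ e2; have [M [D [MD muD]]] := hB _ e2.
have LC' := word_upto_saturatedW _ _ _ (leq_maxl L M) LC.
have MD' := word_upto_saturatedW _ _ _ (leq_maxr L M) MD.
have mC := word_upto_saturated_measurable _ _ LC.
have mD := word_upto_saturated_measurable _ _ MD.
exists (maxn L M), (C `|` D); split.
  by move=> x y xy [Cx|Dx]; [left; exact: LC' Cx|right; exact: MD' Dx].
have mAC : measurable ((A `\` C) `|` (C `\` A)) by apply: measurableU; exact: measurableD.
have mBD : measurable ((B `\` D) `|` (D `\` B)) by apply: measurableU; exact: measurableD.
rewrite (splitr e) EFinD; apply: le_lt_trans (lteD muC muD).
apply: le_trans (measureU2 _ mAC mBD); apply: le_measure; rewrite ?inE.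
- by apply: measurableU; apply: measurableD; apply: measurableU.
- exact: measurableU.
move=> x [[[Ax|Bx] /not_orP[nC nD]]|[[Cx|Dx] /not_orP[nA nB]]].
- by left; left.
- by right; left.
- by left; right.
- by right; right.
Qed.

(** Half of [e] pays for cutting the union at a finite stage, by continuity from above; the other
    half approximates that finite union. *)
Lemma approximable_bigcup (F : nat -> set cms_shiftSpace) :
  (forall k, approximable (F k)) -> approximable (\bigcup_k F k).
Proof.
move=> hF; pose U n := \big[setU/set0]_(k < n) F k.
have hU n : approximable (U n).
  rewrite /U; elim: n => [|n IH].
    rewrite big_ord0; split => // e e0; exists 0%N, set0; split => //.
    by rewrite setD0 setU0 measure0 lte_fin.
  by rewrite big_ord_recr; exact: approximableU.
have mF : measurable (\bigcup_k F k) by apply: bigcup_measurable => k _; case: (hF k).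
have mU n : measurable (U n) by case: (hU n).
split=> // e e0; have e2 : 0 < e / 2 by rewrite divr_gt0.
pose G n := (\bigcup_k F k) `\` U n.
have mG n : measurable (G n) by exact: measurableD.
have G0 : \bigcap_n G n = set0.
  apply/seteqP; split => // x Gx; have [[k _ Fx] _] := Gx 0%N I.
  have [_] := Gx k.+1 I; apply; rewrite /U -bigcup_mkord.
  by exists k => //=.
have cG : (mu \o G) n @[n --> \oo] --> mu (\bigcap_n G n).
  apply: nonincreasing_cvg_mu => //.
  - by rewrite (le_lt_trans (probability_le1 _ _))// ltry.
  - by rewrite G0.
  - apply/nonincreasing_seqP => n; apply/subsetPset => x [Fx nU]; split => //.
    by apply: contra_not nU; rewrite /U big_ord_recr; left.
rewrite G0 measure0 in cG.
have [N] : exists n, (mu (G n) < (e / 2)%:E)%E.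
  have : \forall n \near \oo, ((mu \o G) n < (e / 2)%:E)%E.
    by apply: (cG (fun u => (u < (e / 2)%:E)%E)); apply: open_ereal_lt'; rewrite lte_fin.
  by case=> n _ /(_ n (leqnn n)); exists n.
have [_ /(_ _ e2) [L [C [LC muC]]]] := hU N.
move=> muG; exists L, C; split => //.
have mC := word_upto_saturated_measurable _ _ LC.
have mUC : measurable ((U N `\` C) `|` (C `\` U N)) by apply: measurableU; exact: measurableD.
rewrite (splitr e) EFinD; apply: le_lt_trans (lteD muC muG).
apply: le_trans (measureU2 _ mUC (mG N)); apply: le_measure; rewrite ?inE.
- by apply: measurableU; apply: measurableD.
- exact: measurableU.
move=> x [[Fx nC]|[Cx nF]].
  have [Ux|nU] := pselect (U N x); first by left; left.
  by right.
left; right; split => //; apply: contra_not nF.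
by rewrite /U -bigcup_mkord => -[k _ Fk]; exists k.
Qed.

Lemma measurable_approximable (A : set cms_shiftSpace) : measurable A -> approximable A.
Proof.
suff : <<s cms_cylinders>> `<=` approximable by exact.
apply: smallest_sub => [|_ [n [w ->]]].
  split=> [|B [mB hB]|F hF]; last exact: approximable_bigcup.
    split => // e e0; exists 0%N, set0; split => //.
    by rewrite setD0 setU0 measure0 lte_fin.
  split; first exact: measurableD.
  move=> e e0; have [L [C [LC muC]]] := hB _ e0; exists L, (~` C); split.
    by move=> x y /esym xy nC; apply: contra_not nC; exact: LC.
  by move: muC; rewrite setTD !setDE !setCK setUC (setIC (~` C)) (setIC (~` B)).
(* [L] strictly exceeds every letter of [w], so capping letters at [L] confuses none of them with a
   larger one. *)
pose L := maxn n (\max_(k < n) (w k).+1).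
have nL : (n <= L)%N by exact: leq_maxl.
have wL k : (k < n)%N -> (w k < L)%N.
  move=> kn; apply: leq_trans (leq_maxr _ _).
  exact: (leq_bigmax_cond (F := fun k : 'I_n => (w k).+1) (Ordinal kn)).
split; first by apply: sub_sigma_algebra; exists n, w.
move=> e e0; exists L, [set x | forall k, (k < n)%N -> x k = w k]; split.
  move=> x y /word_upto_eq xy xw k kn; have := xy k (leq_trans kn nL).
  rewrite xw//; have /minn_idPl-> := ltnW (wL k kn).
  by have := wL k kn; rewrite /minn; case: ifP => // _ h E; rewrite E ltnn in h.
by rewrite setDv setU0 measure0 lte_fin.
Qed.

End approximation.

(** * Kolmogorov-Sinai entropy bounded through truncated alphabets *)

Definition cyl1 (i : nat) : set cms_shiftSpace := [set x | x 0%N = i].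

Definition cyl1_from (K : nat) : set cms_shiftSpace := [set x | (K <= x 0%N)%N].

Lemma measurable_cyl1 (i : nat) : measurable (cyl1 i).
Proof. by apply: (@finite_dim_measurable 1) => x y xy; rewrite /cyl1/= xy. Qed.

Lemma measurable_cyl1_from (K : nat) : measurable (cyl1_from K).
Proof. by apply: (@finite_dim_measurable 1) => x y xy; rewrite /cyl1_from/= xy. Qed.

Section entropy_of_partitions.
Context {R : realType} (mu : probability cms_shiftSpace R).

Definition event {Om : Type} (A : set Om) (x : Om) : bool := x \in A.

Lemma finite_rv_event (A : set cms_shiftSpace) : measurable A -> finite_rv (event A).
Proof.
move=> mA [].
  rewrite [X in measurable X](_ : _ = A)//.
  by apply/seteqP; split => x /=; rewrite /event; [move/set_mem|move/mem_set].
rewrite [X in measurable X](_ : _ = ~` A); first exact: measurableC.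
apply/seteqP; split => x /=; rewrite /event.
  by move/negbT/negP; apply: contra_not => /mem_set.
by move=> nA; apply/negbTE/negP => /set_mem.
Qed.

Lemma shannon_event (A : set cms_shiftSpace) : measurable A ->
  shannon mu (event A) = cms_etaH (fine (mu A)) + cms_etaH (1 - fine (mu A)).
Proof.
move=> mA; rewrite /shannon big_bool/=; congr (cms_etaH _ + cms_etaH _).
  congr (fine (mu _)).
  by apply/seteqP; split => x /=; rewrite /event; [move/set_mem|move/mem_set].
rewrite [X in mu X](_ : _ = ~` A); last first.
  apply/seteqP; split => x /=; rewrite /event.
    by move/negbT/negP; apply: contra_not => /mem_set.
  by move=> nA; apply/negbTE/negP => /set_mem.
by rewrite probability_setC// fineB// fin_num_measure.
Qed.

(* [A] is determined by [C] and by the event [D] where they differ, so its entropy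
   given [C] is at most the entropy of [D], a small event. *)
Lemma cond_shannon_event_small (A : set cms_shiftSpace) (e : R) :
  measurable A -> 0 < e ->
  exists L0, forall L, (L0 <= L)%N -> cond_shannon mu (event A) (word_upto L) < e.
Proof.
move=> mA e0.
have [d d0 hd] : exists2 d : R, 0 < d &
    forall p, 0 <= p -> p < d -> cms_etaH p + cms_etaH (1 - p) < e.
  have c : (fun p : R => cms_etaH p + cms_etaH (1 - p)) @ 0 -->
      cms_etaH 0 + cms_etaH (1 - 0 : R).
    apply: cvgD; first exact: etaH_continuous.
    apply: continuous_cvg; first by apply: etaH_continuous; rewrite subr0.
    by apply: cvgB; [exact: cvg_cst|exact: cvg_id].
  rewrite subr0 etaH1 etaH0 addr0 in c.
  have [d d0 hd] := cvgr_lt _ c _ e0.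
  exists d => // p p0 pd; apply: hd => /=.
  by rewrite sub0r normrN ger0_norm.
have [_ /(_ _ d0) [L0 [C [CL muD]]]] := measurable_approximable mu A mA.
have mC := word_upto_saturated_measurable _ _ CL.
set D := (A `\` C) `|` (C `\` A) in muD.
have mD : measurable D by apply: measurableU; exact: measurableD.
exists L0 => L L0L.
apply: (@le_lt_trans _ _ (cond_shannon mu (event A) (event C))).
  apply: cond_shannon_le; [exact: finite_rv_event|exact: finite_rv_word_upto|].
  move=> x y xy; have CL' := word_upto_saturatedW _ _ _ L0L CL.
  by apply/idP/idP => /set_mem Cx; apply/mem_set; [exact: CL' Cx|exact: CL' (esym xy) Cx].
apply: (@le_lt_trans _ _ (shannon mu (event D))); last first.
  rewrite shannon_event//; apply: hd; first by rewrite fine_ge0.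
  by rewrite -lte_fin fineK// fin_num_measure.
rewrite /cond_shannon lerBlDr.
apply: le_trans (shannon_subadditive mu _ _ (finite_rv_event _ mD) (finite_rv_event _ mC)).
apply: shannon_le; first exact: finite_rv_pair (finite_rv_event _ mD) (finite_rv_event _ mC).
have ACD x : event A x = event D x (+) event C x.
  rewrite /event /D in_setU !in_setD; by case: (x \in A); case: (x \in C).
by move=> x y [xD xC]; rewrite !ACD xD xC.
Qed.

(** [X] is recovered from the indicators of its fibres. They are adjoined one value at a time: [Y r]
    is [X] with all values outside [r] merged into [None]. *)
Lemma cond_shannon_events {S T : finType} (X : cms_shiftSpace -> S)
  (Z : cms_shiftSpace -> T) : finite_rv X -> finite_rv Z ->
  cond_shannon mu X Z <= \sum_a cond_shannon mu (event (X @^-1` [set a])) Z.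
Proof.
move=> mX mZ.
pose Y (r : seq S) x := if X x \in r then Some (X x) else None.
have mY r : finite_rv (Y r) by apply: finite_rv_determined mX _ => x y; rewrite /Y => ->.
have mE a : finite_rv (event (X @^-1` [set a])) := finite_rv_event _ (mX a).
have XE a x : event (X @^-1` [set a]) x = (X x == a).
  by apply/idP/idP => [/set_mem/= ->//|/eqP Xa]; exact/mem_set.
have key r : cond_shannon mu (Y r) Z <=
    \sum_(a <- r) cond_shannon mu (event (X @^-1` [set a])) Z.
  elim: r => [|a r IH].
    rewrite big_nil subr_le0; apply: (shannon_le mu _ _ mZ) => x y ->.
    by rewrite /Y !in_nil.
  rewrite big_cons.
  have := shannon_submodular mu _ _ _ (mE a) (mY r) mZ.
  have : shannon mu (fun x => (Y (a :: r) x, Z x)) <=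
      shannon mu (fun x => (event (X @^-1` [set a]) x, Y r x, Z x)).
    apply: shannon_le.
      exact: finite_rv_pair (finite_rv_pair _ _ (mE a) (mY r)) mZ.
    move=> x y []; rewrite !XE => Ea Yr ->; congr (_, _); move: Ea Yr.
    rewrite /Y !in_cons; have [->|_] := eqVneq (X x) a.
      by move=> /esym/eqP ->; rewrite eqxx.
    by have [] := eqVneq (X y) a.
  move: IH; rewrite /cond_shannon; lra.
apply: le_trans (key (index_enum S)); rewrite /cond_shannon lerD2r.
apply: shannon_le; first exact: finite_rv_pair.
by move=> x y []; rewrite /Y !mem_index_enum => -[->] ->.
Qed.

Lemma cond_shannon_small {S : finType} (X : cms_shiftSpace -> S) (e : R) :
  finite_rv X -> 0 < e ->
  exists L0, forall L, (L0 <= L)%N -> cond_shannon mu X (word_upto L) < e.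
Proof.
move=> mX e0.
(* The successor covers an empty [S] and makes the sum of [#|S|] such terms strictly less than
   [e]. *)
have d0 : 0 < e / (#|S|.+1)%:R by rewrite divr_gt0.
have /choice[L0 hL0] a := cond_shannon_event_small _ _ (mX a) d0.
exists (\max_a L0 a)%N => L LL.
apply: le_lt_trans (cond_shannon_events _ _ mX (finite_rv_word_upto L)) _.
apply: (@le_lt_trans _ _ (\sum_(a : S) e / (#|S|.+1)%:R)).
  apply: ler_sum => a _; apply/ltW/hL0/(leq_trans _ LL).
  exact: leq_bigmax.
rewrite sumr_const -[X in X < _]mulr_natr mulrAC ltr_pdivrMr// ltr_pM2l// ltr_nat.
by rewrite cardT.
Qed.

Lemma shannon_symbol_upto (L : nat) :
  shannon mu (symbol_upto L) =
  \sum_(i < L) cms_etaH (fine (mu (cyl1 i))) +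
  cms_etaH (fine (mu (cyl1_from L))).
Proof.
rewrite /shannon big_ord_recr/=; congr (_ + _).
  apply: eq_bigr => i _; congr (cms_etaH (fine (mu _))).
  apply/seteqP; split => x /=.
    move=> /(congr1 val)/=; rewrite symbol_uptoE /minn; case: ifP => // _ E.
    by have := ltn_ord i; rewrite -E ltnn.
  move=> xi; apply/val_inj; rewrite /= symbol_uptoE xi.
  exact/minn_idPl/ltnW.
congr (cms_etaH (fine (mu _))); apply/seteqP; split => x /=.
  by move=> /(congr1 val)/=; rewrite symbol_uptoE => /minn_idPr.
by move=> xL; apply/val_inj; rewrite /= symbol_uptoE; exact/minn_idPr.
Qed.

Lemma fine_cvg_tail : fine (mu (cyl1_from L)) @[L --> \oo] --> (0 : R).
Proof.
have F0 : \bigcap_n cyl1_from n = set0.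
  apply/seteqP; split => // x Fx; have := Fx (x 0%N).+1 I.
  by rewrite /cyl1_from/= ltnn.
have : (mu \o cyl1_from) n @[n --> \oo] --> mu (\bigcap_n cyl1_from n).
  apply: nonincreasing_cvg_mu => //.
  - by rewrite (le_lt_trans (probability_le1 _ (measurable_cyl1_from _)))// ltry.
  - exact: measurable_cyl1_from.
  - by rewrite F0.
  - by apply/nonincreasing_seqP => n; apply/subsetPset => x; exact: ltnW.
by rewrite F0 measure0 => /fine_cvg.
Qed.

Context (mu_invariant :
  forall A : set cms_shiftSpace, measurable A -> mu (cms_shift @^-1` A) = mu A).

(** Passing from [X] to [symbol_upto L] costs the entropy of [X] given [word_upto L], which is small
    because these words generate. Passing on to [symbol_upto K] costs the difference of two
    one-symbol entropies: the symbols from [K] to [L - 1], bounded by [c], and the last atom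
    [cyl1_from L], whose term vanishes as [L] grows. *)
Lemma entropy_rate_le_symbols {S : finType} (X : cms_shiftSpace -> S) (K : nat) (c : R) :
  finite_rv X ->
  (forall L, \sum_(K <= i < L) cms_etaH (fine (mu (cyl1 i))) <= c) ->
  entropy_rate mu cms_shift X <= entropy_rate mu cms_shift (symbol_upto K) + c.
Proof.
move=> mX hc; apply/ler_addgt0Pr => e e0.
have e2 : 0 < e / 2 by rewrite divr_gt0.
have [L0 hL0] := cond_shannon_small X _ mX e2.
have [L [L0L KL hL]] : exists L, [/\ (L0 <= L)%N, (K <= L)%N &
    cms_etaH (fine (mu (cyl1_from L))) < e / 2].
  have c0 : cms_etaH (fine (mu (cyl1_from L))) @[L --> \oo]
      --> cms_etaH (0 : R).
    by apply: continuous_cvg; [exact: etaH_continuous|exact: fine_cvg_tail].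
  rewrite etaH0 in c0; have [N _ hN] := cvgr_lt _ c0 _ e2.
  exists (maxn N (maxn L0 K)); split.
  - by rewrite (leq_trans (leq_maxl L0 K))// leq_maxr.
  - by rewrite (leq_trans (leq_maxr L0 K))// leq_maxr.
  - by apply: hN; exact: leq_maxl.
have mS k := finite_rv_symbol_upto k.
have h1 := entropy_rate_cond mu cms_shift measurable_cms_shift mu_invariant X
  (symbol_upto L) L mX (mS L).
have h2 := hL0 L L0L; rewrite /word_upto in h2.
have h3 := entropy_rate_cond mu cms_shift measurable_cms_shift mu_invariant (symbol_upto L)
  (symbol_upto K) 1 (mS L) (mS K).
have mI := @finite_rv_itinerary _ cms_shiftSpace _ measurable_cms_shift _
  (symbol_upto K) 1 (mS K).
have h4 : cond_shannon mu (symbol_upto L) (itinerary cms_shift (symbol_upto K) 1) <=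
    shannon mu (symbol_upto L) - shannon mu (symbol_upto K).
  rewrite /cond_shannon lerB//.
    apply: (shannon_le mu _ _ (mS L)) => x y xy; congr (_, _) => //.
    apply/itineraryP => -[|//] _; exact: symbol_upto_determines xy.
  by apply: (shannon_le mu _ _ mI) => x y /itineraryP h; exact: (h 0%N).
have h5 : shannon mu (symbol_upto L) - shannon mu (symbol_upto K) <= c + e / 2.
  rewrite !shannon_symbol_upto -!(big_mkord xpredT
    (fun i => cms_etaH (fine (mu (cyl1 i))))).
  rewrite (big_cat_nat _ KL)//=.
  have := hc L.
  have : 0 <= cms_etaH (fine (mu (cyl1_from K))).
    have /andP[] := fine_probability_bounds mu _ (measurable_cyl1_from K).
    exact: etaH_ge0.
  lra.
lra.
Qed.

Lemma cms_entropy_wrtE (k : nat) (P : 'I_k -> set cms_shiftSpace)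
  (X : cms_shiftSpace -> 'I_k) : (forall i, P i = X @^-1` [set i]) ->
  cms_entropy_wrt mu P = entropy_rate mu cms_shift X.
Proof.
move=> PX; rewrite /cms_entropy_wrt /entropy_rate.
suff E : (fun n => cms_part_entropy mu n P / n%:R) =
  (fun n => shannon mu (itinerary cms_shift X n) / n%:R) by rewrite E.
apply/funext => n; rewrite /cms_part_entropy /shannon; congr (_ / _).
apply: eq_bigr => w _; congr (cms_etaH (fine (mu _))).
apply/seteqP; split => x /=.
  by move=> h; apply/ffunP => i; rewrite ffunE; have := h i; rewrite PX.
by move=> <- i; rewrite PX ffunE.
Qed.

Lemma cms_finite_partition_rv (k : nat) (P : 'I_k -> set cms_shiftSpace) :
  cms_finite_partition P -> exists2 X : cms_shiftSpace -> 'I_k,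
    finite_rv X & forall i, P i = X @^-1` [set i].
Proof.
move=> [mP dP cP].
have /choice[X PX] x : exists i, P i x.
  by have : [set: cms_shiftSpace] x by []; rewrite -cP => -[i _ Pi]; exists i.
have PE i : P i = X @^-1` [set i].
  apply/seteqP; split => x /=; last by move=> <-.
  move=> Pix; apply/eqP/negPn/negP => Xi.
  have : (P (X x) `&` P i) x by split.
  by rewrite dP.
by exists X => // i; rewrite -PE.
Qed.

Lemma cms_ks_entropy_le (c : R) :
  (forall (k : nat) (X : cms_shiftSpace -> 'I_k), finite_rv X ->
    entropy_rate mu cms_shift X <= c) ->
  (cms_ks_entropy mu <= c%:E)%E.
Proof.
move=> h; apply: ge_ereal_sup => _ [k [P [/cms_finite_partition_rv[X mX PX] ->]]].
by rewrite lee_fin (cms_entropy_wrtE _ _ _ PX) h.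
Qed.

Lemma cms_ks_entropy_ge (k : nat) (X : cms_shiftSpace -> 'I_k) : finite_rv X ->
  ((entropy_rate mu cms_shift X)%:E <= cms_ks_entropy mu)%E.
Proof.
move=> mX; apply: ereal_sup_ubound; exists k, (fun i => X @^-1` [set i]).
split; last by rewrite (cms_entropy_wrtE _ _ X).
split => // [i j /eqP ij|].
  by apply/seteqP; split => // x /= [Xi Xj]; apply: ij; rewrite -Xi.
by apply/seteqP; split => // x _; exists (X x).
Qed.

End entropy_of_partitions.

Lemma cvgr_sum {R : realType} {T I : Type} (F : set_system T) (r : seq I)
  (f : I -> T -> R) (l : I -> R) : Filter F ->
  (forall i, f i x @[x --> F] --> l i) ->
  \sum_(i <- r) f i x @[x --> F] --> \sum_(i <- r) l i.
Proof.
move=> FF fl; elim: r => [|i r IH].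
  rewrite big_nil (_ : (fun x => _) = fun=> 0); first exact: cvg_cst.
  by apply/funext => x; rewrite big_nil.
rewrite big_cons (_ : (fun x => _) = fun x => f i x + \sum_(j <- r) f j x).
  exact: cvgD.
by apply/funext => x; rewrite big_cons.
Qed.

(** * Weak limits of invariant measures *)

Lemma finite_dim_continuous {R : realType} (n : nat) (phi : {ptws nat -> nat} -> R) :
  (forall x y : nat -> nat, (forall k, (k < n)%N -> x k = y k) -> phi x = phi y) ->
  continuous phi.
Proof.
move=> hphi x A /nbhs_singleton Ax.
have : nbhs x [set y : {ptws nat -> nat} | forall i : 'I_n, y i = x i].
  have FF : Filter (nbhs x) := nbhs_filter x.
  apply: (@filter_forall _ _ (fun (i : 'I_n) (y : {ptws nat -> nat}) => y i = x i) _ FF) => i.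
  apply: (@proj_continuous nat (fun=> nat) i x [set x i]).
  exact: discrete_set1.
apply: filterS => y xy /=; rewrite (hphi y x)// => k kn.
exact: (xy (Ordinal kn)).
Qed.

Section weak_limit.
Context {R : realType} (mus : R -> probability cms_shiftSpace R)
  (m : probability cms_shiftSpace R) (mus_m : cms_weak_cvg_pinfty mus m).

(** The indicator of a clopen set is itself a bounded continuous test function. *)
Lemma weak_cvg_finite_dim (n : nat) (A : set (nat -> nat)) : finite_dim n A ->
  mus t A @[t --> +oo%R] --> m A.
Proof.
move=> nA; have mA := @finite_dim_measurable n A nA.
have cA : continuous (\1_A : {ptws nat -> nat} -> R).
  apply: (@finite_dim_continuous _ n) => x y xy; rewrite !indicE.
  suff -> : (x \in A) = (y \in A) by [].
  by apply/idP/idP => /set_mem Ax; apply/mem_set; apply: nA Ax => // k /xy.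
have bA : exists C : R, forall x : {ptws nat -> nat}, `|\1_A x : R| <= C.
  by exists 1 => x; rewrite indicE; case: (x \in A); rewrite ?normr1// normr0.
have := mus_m _ cA bA.
rewrite integral_indic// setIT; under eq_fun do rewrite integral_indic// setIT.
exact.
Qed.

Lemma weak_cvg_fine (n : nat) (A : set (nat -> nat)) : finite_dim n A ->
  fine (mus t A) @[t --> +oo%R] --> fine (m A).
Proof.
move=> nA; have mA := @finite_dim_measurable n A nA.
have := weak_cvg_finite_dim n A nA.
by rewrite -{1}(fineK (fin_num_measure m _ mA)) => /fine_cvg.
Qed.

Lemma weak_cvg_shannon {T : finType} (n : nat) (X : cms_shiftSpace -> T) :
  (forall a, finite_dim n (X @^-1` [set a])) ->
  shannon (mus t) X @[t --> +oo%R] --> shannon m X.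
Proof.
move=> nX; rewrite /shannon.
apply: cvgr_sum => a.
apply: continuous_cvg; first by apply: etaH_continuous; rewrite fine_ge0.
exact: weak_cvg_fine.
Qed.

Context (M : nat -> nat -> bool) (t0 : R)
  (mus_invariant : forall t, t0 < t -> cms_invariant M (mus t)).

(** The complement is the countable union over [i] of the clopen events of a forbidden transition at
    time [i]. Each is null for [mus t] with [t] large, hence null in the limit. *)
Lemma weak_limit_Sigma : m (cms_Sigma M) = 1%E.
Proof.
pose B i := [set x : cms_shiftSpace | ~~ M (x i) (x i.+1)].
have fB i : finite_dim i.+2 (B i).
  by move=> x y xy; rewrite /B/= !xy.
have mB i : measurable (B i) := finite_dim_measurable _ _ (fB i).
have BE : ~` (cms_Sigma M) = \bigcup_i B i.
  apply/seteqP; split => [x /existsNP[i /negP Bx]|x [i _ /negP Bx] h]; first by exists i.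
  exact: Bx (h i).
have mS : measurable (cms_Sigma M : set cms_shiftSpace).
  by rewrite -[cms_Sigma M]setCK BE; apply: measurableC; exact: bigcupT_measurable.
have B0 i : m (B i) = 0%E.
  have : (fun _ : R => 0%E : \bar R) @ +oo%R --> m (B i).
    have hB := weak_cvg_finite_dim _ _ (fB i).
    apply: cvg_trans hB; apply: near_eq_cvg; near=> t.
    have [S1 _] : cms_invariant M (mus t).
      by apply: mus_invariant; near: t; apply: nbhs_pinfty_gt; exact: num_real.
    suff : mus t (B i) = 0%E by [].
    apply/eqP; rewrite -measure_le0.
    have <- : mus t (~` (cms_Sigma M)) = 0%E by rewrite probability_setC// S1 subee.
    by apply: le_measure; rewrite ?inE//; [exact: measurableC|rewrite BE; exact: bigcup_sup].
  move=> h; apply/esym.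
  exact: (@cvg_unique _ (@ereal_hausdorff R) _ _ _ _ (cvg_cst 0%E) h).
have : m (~` (cms_Sigma M)) = 0%E.
  rewrite BE; apply/eqP; rewrite -measure_le0.
  have mU : measurable (\bigcup_i B i) by exact: bigcupT_measurable.
  apply: le_trans (measure_sigma_subadditive m mB mU (@subset_refl _ _)) _.
  by rewrite eseries0// => i _ _; exact: B0.
move=> h; have := probability_setC m mS; rewrite h => /esym/eqP.
by rewrite sube_eq// ?fin_num_measure// add0e => /eqP.
Unshelve. all: by end_near. Qed.

Lemma weak_limit_invariant : cms_invariant M m.
Proof.
split; first exact: weak_limit_Sigma.
(* The finite-dimensional sets form a generating pi-system stable under preimage by the shift.
   Invariance passes to the limit on them, and a Dynkin argument extends it. *)
pose G : set (set cms_shiftSpace) := [set A | exists n, finite_dim n A].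
have mG : @measurable _ cms_shiftSpace = <<s G>>.
  apply/seteqP; split.
    apply: smallest_sub; first exact: smallest_sigma_algebra.
    move=> _ [n [w ->]]; apply: sub_sigma_algebra; exists n => x y xy xw k kn.
    by rewrite -xy// xw.
  apply: smallest_sub; first exact: sigma_algebra_measurable.
  by move=> A [n nA]; exact: finite_dim_measurable nA.
suff h A : <<s G>> A -> m (cms_shift @^-1` A) = m A by move=> A; rewrite mG; exact: h.
move: A; apply: (@dynkin_induction _ cms_shiftSpace G
  (fun A => m (cms_shift @^-1` A) = m A) mG) => //.
- move=> B C [n nB] [k kC]; exists (maxn n k) => x y xy [Bx Cx]; split.
    by apply: nB Bx => i ni; apply: xy; rewrite (leq_trans ni)// leq_maxl.
  by apply: kC Cx => i ni; apply: xy; rewrite (leq_trans ni)// leq_maxr.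
- move=> B [n nB]; have mB := finite_dim_measurable _ _ nB.
  have nsB : finite_dim n.+1 (cms_shift @^-1` B).
    by move=> x y xy; apply: nB => k kn; exact: xy.
  have h1 := weak_cvg_finite_dim _ _ nB.
  have h2 := weak_cvg_finite_dim _ _ nsB.
  apply: (@cvg_unique _ (@ereal_hausdorff R) _ _ _ _ h2).
  apply: cvg_trans h1; apply: near_eq_cvg; near=> t.
  have [_ inv] : cms_invariant M (mus t).
    by apply: mus_invariant; near: t; apply: nbhs_pinfty_gt; exact: num_real.
  exact/esym/inv.
- move=> B mB /= sB; rewrite preimage_setC !probability_setC ?sB//.
  exact: measurable_cms_shift.
- move=> F mF tF /= sF; rewrite preimage_bigcup !measure_bigcup//.
  + by apply: eq_eseriesr => n _; exact: sF.
  + by move=> n _; exact: measurable_cms_shift.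
  + by move=> i j _ _ [x [Fi Fj]]; apply: tF => //; exists (cms_shift x).
Unshelve. all: by end_near. Qed.

End weak_limit.

(** * Integrals of the potential and tails of the entropy *)

Lemma finite_dim_measurable_fun {d} {T : sigmaRingType d} (n : nat)
  (D : set cms_shiftSpace) (h : cms_shiftSpace -> T) :
  (forall x y : nat -> nat, (forall k, (k < n)%N -> x k = y k) -> h x = h y) ->
  measurable_fun D h.
Proof.
move=> hn mD A mA; apply: measurableI => //.
by apply: (@finite_dim_measurable n) => x y xy /=; rewrite (hn x y xy).
Qed.

Lemma measurable_Sigma (M : nat -> nat -> bool) :
  measurable (cms_Sigma M : set cms_shiftSpace).
Proof.
rewrite (_ : cms_Sigma M = \bigcap_i [set x : cms_shiftSpace | M (x i) (x i.+1)]).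
  apply: bigcapT_measurable => i.
  by apply: (@finite_dim_measurable i.+2) => x y xy; rewrite /= !xy.
by apply/seteqP; split => x h i; [move=> _; exact: h|exact: (h i I)].
Qed.

Lemma series_le_lim {R : realType} (a : nat -> R) (n m : nat) :
  (forall i, 0 <= a i) -> cvgn (series a) -> (n <= m)%N ->
  \sum_(n <= i < m) a i <= limn (series a) - series a n.
Proof.
move=> a0 ca nm; rewrite lerBrDl.
have -> : series a n + \sum_(n <= i < m) a i = series a m.
  by rewrite /series/= -big_cat_nat.
by apply: nondecreasing_cvgn_le => //; apply: nondecreasing_series => i _ _.
Qed.

Lemma series_tail_small {R : realType} (a : nat -> R) (e : R) :
  (forall i, 0 <= a i) -> cvgn (series a) -> 0 < e ->
  exists K0, forall K L, (K0 <= K)%N -> \sum_(K <= i < L) a i <= e.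
Proof.
move=> a0 ca e0.
have lt_e : limn (series a) - e < limn (series a) by rewrite ltrBlDr ltrDl.
have [K0 _ hK] := cvgr_gt _ ca _ lt_e.
exists K0 => K L /hK/= h.
have [LK|KL] := leqP L K; first by rewrite big_geq// ltW.
apply: le_trans (series_le_lim _ _ _ a0 ca (ltnW KL)) _.
by rewrite lerBlDr -lerBlDl ltW.
Qed.

(* [exp (- w a)] is [exp (sup f|[a]) + 2^-a]: the second term keeps [w a] finite
   when the cylinder [a] is empty. *)
Lemma markov_summable_weights {R : realType} (M : nat -> nat -> bool)
  (f : (nat -> nat) -> R) : cms_summable M f -> cms_markov_potential M f ->
  exists (C : R) (u : nat -> nat -> R) (w : nat -> R),
    [/\ forall a b, 0 <= u a b, forall a b, w a <= u a b,
      forall x, cms_Sigma M x -> f x = C - u (x 0%N) (x 1%N) &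
      cvgn (series (fun a => expR (- w a)))].
Proof.
move=> sf [g fg].
pose e a := fine (expeR (cms_sup_cyl M f a)).
have ge0 a : (0 <= expeR (cms_sup_cyl M f a))%E by exact: expeR_ge0.
have se L : (\sum_(0 <= i < L) expeR (cms_sup_cyl M f i) <=
    \sum_(0 <= i <oo) expeR (cms_sup_cyl M f i))%E.
  by apply: nneseries_lim_ge.
have fin a : expeR (cms_sup_cyl M f a) \is a fin_num.
  rewrite ge0_fin_numE//; apply: le_lt_trans sf; apply: le_trans (se a.+1).
  by rewrite big_nat_recr//= leeDr// sume_ge0.
have eE a : (e a)%:E = expeR (cms_sup_cyl M f a) by rewrite fineK.
have e0 a : 0 <= e a by rewrite fine_ge0.
pose E := fine (\sum_(0 <= i <oo) expeR (cms_sup_cyl M f i)).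
have seE L : \sum_(0 <= i < L) e i <= E.
  rewrite -lee_fin fineK; last by rewrite ge0_fin_numE// nneseries_ge0.
  by rewrite -sumEFin; under eq_bigr do rewrite eE.
have eE1 a : e a <= E.
  by apply: le_trans (seE a.+1); rewrite big_nat_recr//= lerDr sumr_ge0.
have fe x : cms_Sigma M x -> expR (f x) <= e (x 0%N).
  move=> Sx; rewrite -lee_fin eE -[(expR (f x))%:E]/(expeR (f x)%:E) lee_expeR.
  by apply: ereal_sup_ubound; exists x.
pose e' a := e a + geometric 1 2^-1 a.
have e'0 a : 0 < e' a by rewrite ltr_wpDl// /geometric/= mul1r exprn_gt0.
have ee' a : e a <= e' a by rewrite lerDl /geometric/= mul1r exprn_ge0.
have E0 : 0 <= E by rewrite (le_trans (e0 0%N)).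
(* Since [exp f] is at most [e (x 0) <= E], and [ln (1 + E) >= 0], the last argument of the maximum
   already dominates the others along points of the shift. The maxima only alter [u] at pairs that
   begin no such point. *)
exists (ln (1 + E)), (fun a b => Num.max (Num.max 0 (- ln (e' a))) (ln (1 + E) - g a b)),
  (fun a => - ln (e' a)); split.
- by move=> a b; rewrite !le_max lexx.
- by move=> a b; rewrite !le_max lexx orbT.
- move=> x Sx; rewrite -fg// (max_idPr _) ?subKr//.
  have fex := fe x Sx; rewrite ge_max subr_ge0; apply/andP; split.
    rewrite -ler_expR lnK ?posrE ?ltr_wpDr//.
    by rewrite (le_trans fex)// (le_trans (eE1 _))// lerDr.
  rewrite lerBrDl; apply: (@le_trans _ _ 0); last by rewrite ln_ge0// lerDl.
  rewrite subr_le0 -ler_expR lnK ?posrE//.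
  exact: le_trans fex (ee' _).
- rewrite (_ : (fun a => _) = e \+ geometric 1 2^-1).
    apply: is_cvg_seriesD.
      apply: nondecreasing_is_cvgn; first by apply: nondecreasing_series => i _ _.
      by exists E => _ [n _ <-]; exact: seE.
    by apply: is_cvg_geometric_series; rewrite ger0_norm// invf_lt1// ltr1n.
  by apply/funext => a; rewrite opprK lnK ?posrE.
Qed.

Definition weight {R : realType} (u : nat -> nat -> R) (x : cms_shiftSpace) : R :=
  u (x 0%N) (x 1%N).

Section weighted_shift.
Context {R : realType} (M : nat -> nat -> bool) (f : (nat -> nat) -> R)
  (C : R) (u : nat -> nat -> R) (w : nat -> R).
Context (u_ge0 : forall a b, 0 <= u a b) (wu : forall a b, w a <= u a b)
  (fE : forall x, cms_Sigma M x -> f x = C - u (x 0%N) (x 1%N))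
  (w_summable : cvgn (series (fun a => expR (- w a)))).

Implicit Types (mu : probability cms_shiftSpace R) (t c : R).

Local Notation U := (weight u).

Let U_ge0 x : 0 <= U x.
Proof. exact: u_ge0. Qed.

(** Taken over the whole sequence space, on which weak convergence is tested; for measures carried
    by [cms_Sigma M] the domain makes no difference. *)
Definition weight_integral mu : \bar R :=
  (\int[mu]_x (U x)%:E)%E.

Local Notation J := weight_integral.

Lemma measurable_weight {d} {T : sigmaRingType d} (h : R -> T) D :
  measurable_fun D (h \o U).
Proof. by apply: (@finite_dim_measurable_fun _ _ 2) => x y xy; rewrite /weight/= !xy. Qed.

Lemma weight_integral_ge0 mu : (0 <= J mu)%E.
Proof. by apply: integral_ge0 => x _; rewrite lee_fin. Qed.

Lemma weight_integral_Sigma mu : mu (cms_Sigma M) = 1%E ->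
  J mu = (\int[mu]_(x in cms_Sigma M) (U x)%:E)%E.
Proof.
move=> S1; rewrite /weight_integral.
rewrite (@ge0_negligible_integral _ _ _ mu setT (~` cms_Sigma M))//.
- by rewrite setTD setCK.
- by apply: measurableC; exact: measurable_Sigma.
- exact: (measurable_weight EFin).
- by move=> x _; rewrite lee_fin.
- by apply: etrans (probability_setC _ (measurable_Sigma M)) _; rewrite S1 subee.
Qed.

Lemma cms_integ_weight mu t : mu (cms_Sigma M) = 1%E -> 0 < t ->
  cms_integ M mu (fun x => t * f x) =
  (\int[mu]_(x in cms_Sigma M) (t * C - t * U x)%:E)%E.
Proof.
move=> S1 t0; apply: eq_integral => x /set_mem Sx.
by rewrite fE// mulrBr.
Qed.

Lemma cms_integ_fin mu t : mu (cms_Sigma M) = 1%E -> 0 < t -> (J mu < +oo)%E ->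
  cms_integ M mu (fun x => t * f x) = (t * (C - fine (J mu)))%:E.
Proof.
move=> S1 t0 Jfin; have mS := measurable_Sigma M.
have JE : J mu = (fine (J mu))%:E by rewrite fineK// ge0_fin_numE// weight_integral_ge0.
rewrite cms_integ_weight//.
have iU : mu.-integrable (cms_Sigma M) (EFin \o (fun x => t * U x)).
  apply/integrableP; split; first exact: (measurable_weight (fun r => (t * r)%:E)).
  rewrite (eq_integral (fun x => t%:E * (U x)%:E)%E); last first.
    by move=> x _; rewrite /= ger0_norm ?EFinM// mulr_ge0// ltW.
  rewrite ge0_integralZl_EFin ?ltW//.
  - by rewrite -weight_integral_Sigma// JE ltry.
  - by move=> x _; rewrite lee_fin.
  - exact: (measurable_weight EFin).
have iC : mu.-integrable (cms_Sigma M) (EFin \o cst (t * C)).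
  exact: finite_measure_integrable_cst.
under eq_integral do rewrite EFinB.
rewrite (integralB_EFin mS iC iU).
rewrite (integral_cst mu mS (t * C)%:E) [X in (_ * X)%E]S1 mule1.
under [X in (_ - X)%E]eq_integral do rewrite EFinM.
rewrite ge0_integralZl_EFin ?ltW//.
- by rewrite -weight_integral_Sigma// JE mulrBr EFinB EFinM.
- by move=> x _; rewrite lee_fin.
- exact: (measurable_weight EFin).
Qed.

(** The positive part of [t f] is at most [|t C|], so an integral above [-oo] forces the negative
    part to be integrable, and [t u] exceeds that part by at most [|t C|]. *)
Lemma cms_integ_gtNy mu t : mu (cms_Sigma M) = 1%E -> 0 < t ->
  (-oo < cms_integ M mu (fun x => (t * f x)%R))%E -> (J mu < +oo)%E.
Proof.
move=> S1 t0; have mS := measurable_Sigma M; rewrite cms_integ_weight//.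
set g := fun x => (t * C - t * U x)%:E => gNy.
have mg : measurable_fun (cms_Sigma M : set cms_shiftSpace) g.
  exact: (measurable_weight (fun r => (t * C - t * r)%:E)).
have gneg : (\int[mu]_(x in cms_Sigma M) g^\- x < +oo)%E.
  rewrite ltey; apply/eqP => gy; move: gNy; rewrite integralE gy.
  suff : ((\int[mu]_(x in cms_Sigma M) g^\+ x)%E < +oo)%E.
    by case: (integral _ _ _) => [r||].
  apply: (@le_lt_trans _ _ (\int[mu]_(x in cms_Sigma M) (cst (`|t * C|%:E) x))%E).
    apply: ge0_le_integral => //.
    - exact: measurable_funepos.
    - move=> x _; rewrite funeposE ge_max; apply/andP; split; rewrite lee_fin//.
      by rewrite (le_trans _ (ler_norm _))// lerBlDr lerDl mulr_ge0// ltW.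
  by rewrite integral_cst// [X in (_ * X)%E]S1 mule1 ltry.
have : ((t%:E * J mu)%E < +oo)%E.
  rewrite weight_integral_Sigma// -ge0_integralZl_EFin ?ltW//; last 2 first.
  - by move=> x _; rewrite lee_fin.
  - exact: (measurable_weight EFin).
  apply: (@le_lt_trans _ _ (\int[mu]_(x in cms_Sigma M) (`|t * C|%:E + g^\- x))%E).
    apply: ge0_le_integral => //.
    - by move=> x _; rewrite -EFinM lee_fin mulr_ge0// ltW.
    - exact: (measurable_weight (fun r => (t%:E * r%:E)%E)).
    - by apply: emeasurable_funD => //; exact: measurable_funeneg.
    - move=> x _; rewrite funenegE; apply: (@le_trans _ _ (`|t * C|%:E + - g x)%E).
        rewrite /g -EFinM -EFinN -EFinD lee_fin.
        by have := ler_norm (t * C); lra.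
      by rewrite leeD2l// le_max lexx.
  rewrite ge0_integralD//; last exact: measurable_funeneg.
  by rewrite integral_cst// [X in (_ * X)%E]S1 mule1 lte_add_pinfty// ltry.
by have := weight_integral_ge0 mu; case: (J mu) => [r _ _|_|//]; rewrite ?ltry// gt0_muley.
Qed.

Lemma etaH_cyl1 mu i :
  ((cms_etaH (fine (mu (cyl1 i))))%:E <=
    \int[mu]_(x in cyl1 i) (U x)%:E + (expR (- w i))%:E)%E.
Proof.
have mc := measurable_cyl1 i.
apply: (@le_trans _ _ ((w i)%:E * mu (cyl1 i) + (expR (- w i))%:E)%E).
  rewrite -[X in (_ * X)%E]fineK ?fin_num_measure// -EFinM -EFinD lee_fin mulrC.
  by apply: etaH_gibbs; rewrite fine_ge0.
rewrite leeD2r//.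
(* [w i] may be negative, when [exp (- w i) > 1]; the integral is then bounded below by [0] instead
   of by [w i] times the mass. *)
have [w0|w0] := leP 0 (w i); last first.
  apply: (@le_trans _ _ 0%E); last by apply: integral_ge0 => x _; rewrite lee_fin.
  by rewrite mule_le0_ge0// lee_fin ltW.
rewrite -(integral_cst mu mc); apply: ge0_le_integral => //.
- exact: (measurable_weight EFin).
- by move=> x <-; rewrite lee_fin; exact: wu.
Qed.

Lemma etaH_cyl1_sum mu K L : (J mu < +oo)%E ->
  \sum_(K <= i < L) cms_etaH (fine (mu (cyl1 i))) <=
    fine (\int[mu]_(x in cyl1_from K) (U x)%:E)%E + \sum_(K <= i < L) expR (- w i).
Proof.
move=> Jfin; pose A L := [set x : cms_shiftSpace | (K <= x 0%N < L)%N].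
have mA L' : measurable (A L').
  by apply: (@finite_dim_measurable 1) => x y xy; rewrite /A/= xy.
have mK := measurable_cyl1_from K.
have mU D : measurable_fun D (EFin \o U) := measurable_weight EFin D.
have fK : (\int[mu]_(x in cyl1_from K) (U x)%:E)%E \is a fin_num.
  rewrite ge0_fin_numE; last by apply: integral_ge0 => x _; rewrite lee_fin.
  apply: le_lt_trans Jfin; apply: ge0_subset_integral => //.
  by move=> x _; rewrite lee_fin.
have h L' : ((\sum_(K <= i < L') cms_etaH (fine (mu (cyl1 i))))%:E <=
    \int[mu]_(x in A L') (U x)%:E + (\sum_(K <= i < L') expR (- w i))%:E)%E.
  elim: L' => [|L' IH].
    by rewrite !big_geq// adde0; apply: integral_ge0 => x _; rewrite lee_fin.
  have [LK|KL] := ltnP L' K.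
    by rewrite !big_geq// adde0; apply: integral_ge0 => x _; rewrite lee_fin.
  rewrite !big_nat_recr//= !EFinD.
  have -> : A L'.+1 = A L' `|` cyl1 L'.
    apply/seteqP; split => x; rewrite /A /cyl1/=.
      move=> /andP[Kx]; rewrite ltnS leq_eqVlt => /orP[/eqP->|xL]; first by right.
      by left; rewrite Kx.
    by move=> [/andP[-> /ltnW]|->]; rewrite ltnS// KL leqnn.
  rewrite ge0_integral_setU//; last 3 first.
  - exact: measurable_cyl1.
  - by move=> x _; rewrite lee_fin.
  - apply/disj_setPS => x [/andP[_ xL] /= xE].
    by rewrite /cyl1/= in xE; rewrite xE ltnn in xL.
  apply: le_trans (leeD IH (etaH_cyl1 mu L')) _.
  by rewrite addeACA.
rewrite -lee_fin EFinD fineK//; apply: le_trans (h L) _.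
rewrite leeD2r//; apply: ge0_subset_integral => //.
- by move=> x _; rewrite lee_fin.
- by move=> x /andP[].
Qed.

Lemma cms_ks_entropy_le_weight mu K c : cms_invariant M mu -> (J mu < +oo)%E ->
  (forall L, \sum_(K <= i < L) expR (- w i) <= c) ->
  (cms_ks_entropy mu <= (entropy_rate mu cms_shift (symbol_upto K) +
    (fine (\int[mu]_(x in cyl1_from K) (U x)%:E)%E + c))%:E)%E.
Proof.
move=> [_ inv] Jfin hc; apply: cms_ks_entropy_le => k X mX.
apply: entropy_rate_le_symbols => // L.
by apply: le_trans (etaH_cyl1_sum mu K L Jfin) _; rewrite lerD2l.
Qed.

Lemma cms_ks_entropy_fin_num mu : cms_invariant M mu -> (J mu < +oo)%E ->
  cms_ks_entropy mu \is a fin_num.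
Proof.
move=> inv Jfin; apply: fin_real; apply/andP; split.
  apply: lt_le_trans (cms_ks_entropy_ge mu _ (symbol_upto 0) (finite_rv_symbol_upto 0)).
  by rewrite ltNyr.
apply: le_lt_trans (ltry _); apply: (cms_ks_entropy_le_weight mu 0
  (limn (series (fun a => expR (- w a)))) inv Jfin) => L.
apply: nondecreasing_cvgn_le => //; apply: nondecreasing_series => i _ _.
exact: expR_ge0.
Qed.

Lemma cms_ks_entropy_ge0 mu : cms_invariant M mu -> (0 <= cms_ks_entropy mu)%E.
Proof.
move=> [_ inv].
apply: le_trans (cms_ks_entropy_ge mu _ (symbol_upto 0) (finite_rv_symbol_upto 0)).
rewrite lee_fin; apply: entropy_rate_ge0 => //; last exact: finite_rv_symbol_upto.
exact: measurable_cms_shift.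
Qed.

(* Where [w >= 2 N], the truncation [min u N] misses at least half of [u]. *)
Lemma weight_tail mu N K : (J mu < +oo)%E -> 0 <= N ->
  (forall a, (K <= a)%N -> 2 * N <= w a) ->
  fine (\int[mu]_(x in cyl1_from K) (U x)%:E)%E <=
  2 * (fine (J mu) - fine (\int[mu]_x (Num.min (U x) N)%:E)%E).
Proof.
move=> Jfin N0 wN.
have mK := measurable_cyl1_from K.
have mU D : measurable_fun D (EFin \o U) := measurable_weight EFin D.
have m0 x : 0 <= Num.min (U x) N by rewrite le_min u_ge0.
have V0 x : 0 <= U x - Num.min (U x) N by rewrite subr_ge0 ge_min lexx.
have mV D : measurable_fun D (fun x => (U x - Num.min (U x) N)%:E).
  exact: (measurable_weight (fun r => (r - Num.min r N)%:E)).
have mm D : measurable_fun D (fun x => (Num.min (U x) N)%:E).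
  exact: (measurable_weight (fun r => (Num.min r N)%:E)).
set V := (\int[mu]_x (U x - Num.min (U x) N)%:E)%E.
have JE : J mu = (\int[mu]_x (Num.min (U x) N)%:E + V)%E.
  rewrite -ge0_integralD//; last 2 first.
  - by move=> x _; rewrite lee_fin.
  - by move=> x _; rewrite lee_fin.
  by apply: eq_integral => x _; rewrite -EFinD subrKC.
have I0 : (0 <= \int[mu]_x (Num.min (U x) N)%:E)%E.
  by apply: integral_ge0 => x _; rewrite lee_fin.
have V00 : (0 <= V)%E by apply: integral_ge0 => x _; rewrite lee_fin.
have Ifin : (\int[mu]_x (Num.min (U x) N)%:E)%E \is a fin_num.
  by rewrite ge0_fin_numE//; apply: le_lt_trans Jfin; rewrite JE leeDl.
have Vfin : V \is a fin_num.
  by rewrite ge0_fin_numE//; apply: le_lt_trans Jfin; rewrite JE leeDr.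
have -> : fine (J mu) - fine (\int[mu]_x (Num.min (U x) N)%:E)%E = fine V.
  by rewrite JE (fineD Ifin Vfin) [X in X - _]addrC addrK.
have le1 : (\int[mu]_(x in cyl1_from K) (U x)%:E <= 2%:E * V)%E.
  rewrite -ge0_integralZl_EFin//; last by move=> x _; rewrite lee_fin.
  apply: (@le_trans _ _ (\int[mu]_(x in cyl1_from K) (2%:E * (U x - Num.min (U x) N)%:E))%E).
    apply: ge0_le_integral => //.
    - by move=> x _; rewrite lee_fin.
    - exact: (measurable_weight (fun r => (2%:E * (r - Num.min r N)%:E)%E)).
    - move=> x xK; rewrite -EFinM lee_fin.
      have := le_trans (wN _ xK) (wu (x 0%N) (x 1%N)); rewrite -/(U x) => UN.
      by rewrite (min_idPr _); lra.
  apply: ge0_subset_integral => //.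
  - exact: (measurable_weight (fun r => (2%:E * (r - Num.min r N)%:E)%E)).
  - by move=> x _; rewrite -EFinM lee_fin mulr_ge0.
rewrite -lee_fin EFinM (fineK Vfin) fineK//.
rewrite ge0_fin_numE; last by apply: integral_ge0 => x _; rewrite lee_fin.
by apply: le_lt_trans le1 _; rewrite -[V]fineK// -EFinM ltry.
Qed.

Lemma weight_truncation_lt mu c : (c%:E < J mu)%E ->
  exists N : nat, (c%:E < \int[mu]_x (Num.min (U x) N%:R)%:E)%E.
Proof.
move=> cJ.
have cv : (\int[mu]_x (Num.min (U x) n%:R)%:E)%E @[n --> \oo] --> J mu.
  rewrite /weight_integral.
  under [X in _ --> X]eq_integral => x _.
    rewrite (_ : (U x)%:E = limn (fun n => (Num.min (U x) n%:R)%:E)); first over.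
    apply/esym/cvg_lim => //; apply: cvg_near_cst.
    near=> n; rewrite (min_idPl _)//.
    near: n; exact: nbhs_infty_ger.
  apply: cvg_monotone_convergence => //.
  - by move=> n; exact: (measurable_weight (fun r => (Num.min r n%:R)%:E)).
  - by move=> n x _; rewrite lee_fin le_min u_ge0 ler0n.
  - move=> x _ m n mn; rewrite lee_fin le_min ge_min lexx/= ge_min ler_nat mn.
    by rewrite orbT.
have [N _ hN] := cv (fun v => (c%:E < v)%E) (open_ereal_gt' cJ).
by exists N; apply: (hN N); exact: leqnn.
Unshelve. all: by end_near. Qed.

End weighted_shift.

(** * Zero temperature limit *)

Section zero_temperature.
Context {R : realType} (M : nat -> nat -> bool) (f : (nat -> nat) -> R)
  (C : R) (u : nat -> nat -> R) (w : nat -> R).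
Context (u_ge0 : forall a b, 0 <= u a b) (wu : forall a b, w a <= u a b)
  (fE : forall x, cms_Sigma M x -> f x = C - u (x 0%N) (x 1%N))
  (w_summable : cvgn (series (fun a => expR (- w a)))).
Context (mu_t : R -> probability cms_shiftSpace R) (mu_inf : probability cms_shiftSpace R)
  (mu_eq : forall t : R, 1 < t -> cms_equilibrium_state M (fun x => t * f x) (mu_t t))
  (mu_cvg : cms_weak_cvg_pinfty mu_t mu_inf).

Local Notation J := (weight_integral u).
Local Notation h t := (fine (cms_ks_entropy (mu_t t))).
Local Notation j t := (fine (J (mu_t t))).

Implicit Types (nu : probability cms_shiftSpace R) (s t : R).

Let J_ge0 nu : (0 <= J nu)%E.
Proof. exact: weight_integral_ge0. Qed.

Let JE nu : (J nu < +oo)%E -> J nu = (fine (J nu))%:E.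
Proof. by move=> Jfin; rewrite fineK// ge0_fin_numE. Qed.

Lemma equilibrium_invariant t : 1 < t -> cms_invariant M (mu_t t).
Proof. by move=> /mu_eq[]. Qed.

Lemma equilibrium_weight_fin t : 1 < t -> (J (mu_t t) < +oo)%E.
Proof.
move=> t1; have [[S1 _] I _] := mu_eq t t1.
exact: (cms_integ_gtNy M f C u u_ge0 fE (mu_t t) t S1 (lt_trans ltr01 t1) I).
Qed.

Let ksE nu : cms_invariant M nu -> (J nu < +oo)%E ->
  cms_ks_entropy nu = (fine (cms_ks_entropy nu))%:E.
Proof. by move=> inv Jfin; rewrite fineK//; exact: (cms_ks_entropy_fin_num M u w). Qed.

Lemma equilibrium_variational t nu : 1 < t -> cms_invariant M nu -> (J nu < +oo)%E ->
  fine (cms_ks_entropy nu) + t * j t <= h t + t * fine (J nu).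
Proof.
move=> t1 inv Jfin; have t0 : 0 < t by exact: lt_trans ltr01 t1.
have [mi _ E] := mu_eq t t1; have Jt := equilibrium_weight_fin _ t1.
have Inu := cms_integ_fin M f C u u_ge0 fE nu t inv.1 t0 Jfin.
have Imu := cms_integ_fin M f C u u_ge0 fE (mu_t t) t mi.1 t0 Jt.
have : (cms_ks_entropy nu + cms_integ M nu (fun x => (t * f x)%R) <=
    cms_ks_entropy (mu_t t) + cms_integ M (mu_t t) (fun x => (t * f x)%R))%E.
  rewrite E; apply: ereal_sup_ubound; exists nu => //; split => //.
  by rewrite Inu ltNyr.
rewrite Inu Imu (ksE _ inv Jfin) (ksE _ mi Jt) -!EFinD lee_fin; lra.
Qed.

(** Testing each of the two states against the other and adding gives [(t - s) (j t - j s) <= 0].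
    The inequality at [s] then reads [h t - h s <= s (j t - j s) <= 0]. *)
Lemma equilibrium_entropy_decreasing s t : 1 < s -> s <= t -> h t <= h s.
Proof.
move=> s1; rewrite le_eqVlt => /orP[/eqP->//|st].
have t1 : 1 < t by exact: lt_trans st.
have a := equilibrium_variational _ _ t1 (equilibrium_invariant _ s1)
  (equilibrium_weight_fin _ s1).
have b := equilibrium_variational _ _ s1 (equilibrium_invariant _ t1)
  (equilibrium_weight_fin _ t1).
have jj : j t <= j s.
  have : (t - s) * (j t - j s) <= 0 by lra.
  by rewrite pmulr_rle0 ?subr_gt0// subr_le0.
have : s * (j t - j s) <= 0 by rewrite pmulr_rle0 ?subr_le0// (lt_trans _ s1).
lra.
Qed.

Lemma equilibrium_weight_le nu (e : R) : cms_invariant M nu -> (J nu < +oo)%E -> 0 < e ->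
  \forall t \near +oo%R, j t <= fine (J nu) + e.
Proof.
move=> inv Jfin e0; near=> t.
have t2 : 2 <= t by near: t; apply: nbhs_pinfty_ge; exact: num_real.
(* Beyond this threshold the entropy contribution [h 2 / t] is at most [e]; [2] is just a fixed
   parameter above [1]. *)
have te : h 2 / e <= t by near: t; apply: nbhs_pinfty_ge; exact: num_real.
have t0 : 0 < t by exact: lt_le_trans t2.
have t1 : 1 < t by apply: lt_le_trans t2; rewrite ltr1n.
rewrite -(ler_pM2l t0) mulrDr.
have := equilibrium_variational _ _ t1 inv Jfin.
have := equilibrium_entropy_decreasing 2 t (ltr1n _ 2) t2.
have : 0 <= fine (cms_ks_entropy nu) by rewrite fine_ge0// (cms_ks_entropy_ge0 M).
have : h 2 <= t * e by rewrite -ler_pdivrMr.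
lra.
Unshelve. all: by end_near. Qed.

Let trunc nu (N : nat) := (\int[nu]_x (Num.min (weight u x) N%:R)%:E)%E.

Let trunc_fin nu N : trunc nu N \is a fin_num.
Proof.
rewrite /trunc ge0_fin_numE; last first.
  by apply: integral_ge0 => x _; rewrite lee_fin le_min u_ge0/=.
apply: (@le_lt_trans _ _ (\int[nu]_x (cst N%:R%:E x))%E).
  apply: ge0_le_integral => //.
  - by move=> x _; rewrite lee_fin le_min u_ge0/=.
  - exact: (measurable_weight u (fun r => (Num.min r N%:R)%:E)).
  - by move=> x _; rewrite lee_fin ge_min lexx orbT.
by rewrite integral_cst// [X in (_ * X)%E]probability_setT mule1 ltry.
Qed.

Let trunc_le nu N : (J nu < +oo)%E -> fine (trunc nu N) <= fine (J nu).
Proof.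
move=> Jfin; rewrite -lee_fin fineK// -JE//; apply: ge0_le_integral => //.
- by move=> x _; rewrite lee_fin le_min u_ge0/=.
- exact: (measurable_weight u (fun r => (Num.min r N%:R)%:E)).
- exact: (measurable_weight u EFin).
- by move=> x _; rewrite lee_fin ge_min lexx.
Qed.

Let trunc_cvg N : fine (trunc (mu_t t) N) @[t --> +oo%R] --> fine (trunc mu_inf N).
Proof.
have c : continuous (fun x : {ptws nat -> nat} => Num.min (weight u x) N%:R).
  by apply: (@finite_dim_continuous _ 2) => x y xy; rewrite /weight !xy.
have b : exists B : R, forall x : {ptws nat -> nat},
    `|Num.min (weight u x) N%:R| <= B.
  exists N%:R => x; rewrite ger0_norm ?ge_min ?lexx ?orbT//.
  by rewrite le_min u_ge0/=.
have := mu_cvg _ c b; rewrite -/(trunc mu_inf N) -[trunc mu_inf N]fineK//.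
exact: fine_cvg.
Qed.

Lemma limit_invariant : cms_invariant M mu_inf.
Proof. exact: weak_limit_invariant mu_cvg M 1 equilibrium_invariant. Qed.

(** If [J mu_inf] exceeded [J nu], so would the integral of some truncation [min u N]. That integral
    is the limit of those for [mu_t], which are at most [j t], eventually below [J nu + e]. *)
Lemma limit_weight_minimal nu : cms_invariant M nu -> (J mu_inf <= J nu)%E.
Proof.
move=> inv; have [Jy|] := leP +oo%E (J nu); first by apply: le_trans Jy; exact: leey.
move=> Jfin; rewrite leNgt; apply/negP; rewrite (JE _ Jfin) => lt.
have [N] := weight_truncation_lt u u_ge0 mu_inf _ lt.
rewrite -/(trunc mu_inf N) -[trunc mu_inf N]fineK// lte_fin ltNge => /negP; apply.
apply/ler_addgt0Pr => e e0; apply: cvgr_to_le (trunc_cvg N) _.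
near=> t.
have t1 : 1 < t by near: t; apply: nbhs_pinfty_gt; exact: num_real.
apply: le_trans (trunc_le _ _ (equilibrium_weight_fin _ t1)) _.
by near: t; exact: equilibrium_weight_le.
Unshelve. all: by end_near. Qed.

Lemma limit_weight_fin : (J mu_inf < +oo)%E.
Proof.
have l : 1 < 2 :> R by rewrite ltr1n.
apply: le_lt_trans (equilibrium_weight_fin _ l).
exact: limit_weight_minimal (equilibrium_invariant _ l).
Qed.

Let integ1 nu : cms_integ M nu f = cms_integ M nu (fun x => 1 * f x).
Proof. by congr (cms_integ M nu _); apply/funext => x; rewrite mul1r. Qed.

Lemma beta_max_weight : cms_beta_max M f = (C - fine (J mu_inf))%:E.
Proof.
have I nu (inv : cms_invariant M nu) (Jfin : (J nu < +oo)%E) :=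
  cms_integ_fin M f C u u_ge0 fE nu 1 inv.1 ltr01 Jfin.
apply/le_anti/andP; split.
  apply: ge_ereal_sup => _ [nu inv <-]; rewrite integ1.
  have [Iy|Iy] := leP (cms_integ M nu (fun x => 1 * f x)) -oo%E.
    by apply: le_trans Iy _; exact: leNye.
  have Jfin := cms_integ_gtNy M f C u u_ge0 fE nu 1 inv.1 ltr01 Iy.
  rewrite I// mul1r lee_fin lerB// -lee_fin -!JE//.
    exact: limit_weight_minimal.
  exact: limit_weight_fin.
apply: ereal_sup_ubound; exists mu_inf; first exact: limit_invariant.
by rewrite integ1 I ?mul1r//; [exact: limit_invariant|exact: limit_weight_fin].
Qed.

Lemma limit_maximizing : cms_Mmax M f mu_inf.
Proof.
split; first exact: limit_invariant.
rewrite beta_max_weight integ1 (cms_integ_fin M f C u u_ge0 fE)//.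
- by rewrite mul1r.
- by have [] := limit_invariant.
- exact: limit_weight_fin.
Qed.

Lemma maximizing_weight nu : cms_Mmax M f nu -> J nu = J mu_inf.
Proof.
move=> [inv]; rewrite beta_max_weight integ1 => I.
have Jfin : (J nu < +oo)%E.
  apply: (cms_integ_gtNy M f C u u_ge0 fE nu 1 inv.1 ltr01).
  by rewrite I ltNyr.
move: I; rewrite (cms_integ_fin M f C u u_ge0 fE nu 1 inv.1 ltr01 Jfin) mul1r => -[E].
by rewrite (JE _ Jfin) (JE _ limit_weight_fin); move/addrI/oppr_inj: E => ->.
Qed.

(** A maximizing [nu] has the least energy, so the variational inequality at [t] can only be saved
    by the entropy of [mu_t]. *)
Lemma maximizing_entropy_le nu t : cms_Mmax M f nu -> 1 < t ->
  (cms_ks_entropy nu <= cms_ks_entropy (mu_t t))%E.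
Proof.
move=> mnu t1; have Jnu := maximizing_weight _ mnu; have [inv _] := mnu.
have Jfin : (J nu < +oo)%E by rewrite Jnu; exact: limit_weight_fin.
have Jt := equilibrium_weight_fin _ t1; have it := equilibrium_invariant _ t1.
rewrite (ksE _ inv Jfin) (ksE _ it Jt) lee_fin.
have := equilibrium_variational _ _ t1 inv Jfin.
have : t * fine (J nu) <= t * j t.
  rewrite ler_pM2l ?(lt_trans ltr01 t1)// -lee_fin -!JE// Jnu.
  exact: limit_weight_minimal.
lra.
Qed.

Let h_inf := fine (cms_ks_entropy mu_inf).

Let h_infE : cms_ks_entropy mu_inf = h_inf%:E.
Proof. exact: ksE limit_invariant limit_weight_fin. Qed.

Lemma equilibrium_tail (e : R) : 0 < e -> exists K0 : nat, forall K, (K0 <= K)%N ->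
  \forall t \near +oo%R,
    fine (\int[mu_t t]_(x in cyl1_from K) (weight u x)%:E)%E <= e.
Proof.
(* One quarter for the excess of [j t] over [J mu_inf], one for the energy lost by truncation at
   [N]; [weight_tail] doubles their sum. *)
move=> e0; have e4 : 0 < e / 4 by rewrite divr_gt0.
have [N hN] : exists N : nat, ((fine (J mu_inf) - e / 4)%:E < trunc mu_inf N)%E.
  apply: (weight_truncation_lt u u_ge0).
  by rewrite (JE _ limit_weight_fin) lte_fin ltrBlDr ltrDl.
(* The terms [exp (- w a)] of a convergent series tend to [0], so [w] tends to infinity and passes
   [2 N] from some symbol on. *)
have [K0 _ wK0] := cvgr_lt _ (cvg_series_cvg_0 w_summable) _
  (expR_gt0 (- (2 * N%:R))).
have wN a : (K0 <= a)%N -> 2 * N%:R <= w a.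
  by move=> /wK0/=; rewrite ltr_expR ltrN2 => /ltW.
exists K0 => K K0K; near=> t.
have t1 : 1 < t by near: t; apply: nbhs_pinfty_gt; exact: num_real.
apply: le_trans (weight_tail u w u_ge0 wu (mu_t t) N%:R K
  (equilibrium_weight_fin _ t1) _ _) _ => //.
  by move=> a Ka; apply: wN; exact: leq_trans Ka.
rewrite -/(trunc (mu_t t) N).
have a : j t <= fine (J mu_inf) + e / 4.
  near: t; apply: equilibrium_weight_le => //.
    exact: limit_invariant.
  exact: limit_weight_fin.
have b : fine (J mu_inf) - e / 4 < fine (trunc (mu_t t) N).
  near: t; apply: (cvgr_gt _ (trunc_cvg N)).
  by rewrite -lte_fin fineK.
lra.
Unshelve. all: by end_near. Qed.

(** The order of choices matters: [K] makes the energy tail, for all large [t], and the series tail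
    small; [n] then depends on [mu_inf] alone; [t] comes last, once a single finite partition is
    fixed. *)
Lemma equilibrium_entropy_upper (e : R) : 0 < e ->
  \forall t \near +oo%R, h t <= h_inf + e.
Proof.
move=> e0; have e4 : 0 < e / 4 by rewrite divr_gt0.
have [K1 hK1] := equilibrium_tail _ e4.
have [K2 hK2] := series_tail_small _ _ (fun a => expR_ge0 (- w a)) w_summable e4.
pose K := maxn K1 K2.
have mX := finite_rv_symbol_upto K.
have rate_inf : entropy_rate mu_inf cms_shift (symbol_upto K) <= h_inf.
  by rewrite -lee_fin -h_infE; exact: cms_ks_entropy_ge.
have [n hn] : exists n,
    shannon mu_inf (itinerary cms_shift (symbol_upto K) n.+1) / n.+1%:R < h_inf + e / 4.
  have c := cvg_entropy_rate mu_inf _ measurable_cms_shift limit_invariant.2 _ mX.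
  have lt_e : entropy_rate mu_inf cms_shift (symbol_upto K) < h_inf + e / 4.
    by apply: le_lt_trans rate_inf _; rewrite ltrDl.
  have [n _ hn] := cvgr_lt _ c _ lt_e.
  by exists n; apply: hn => /=.
near=> t.
have t1 : 1 < t by near: t; apply: nbhs_pinfty_gt; exact: num_real.
have inv := equilibrium_invariant _ t1; have Jt := equilibrium_weight_fin _ t1.
have tail : fine (\int[mu_t t]_(x in cyl1_from K) (weight u x)%:E)%E <= e / 4.
  by near: t; apply: hK1; exact: leq_maxl.
have ent : shannon (mu_t t) (itinerary cms_shift (symbol_upto K) n.+1) / n.+1%:R <
    h_inf + e / 4.
  near: t; apply: (cvgr_lt _ _ _ hn); apply: cvgM; last exact: cvg_cst.
  apply: (weak_cvg_shannon _ _ mu_cvg n.+1) => a x y xy /= <-.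
  apply/itineraryP => i ni; apply/symbol_upto_eq; rewrite !iter_cms_shift add0n.
  by rewrite xy.
have ser L : \sum_(K <= i < L) expR (- w i) <= e / 4.
  by apply: hK2; exact: leq_maxr.
have up := cms_ks_entropy_le_weight M u w u_ge0 wu (mu_t t) K _ inv Jt ser.
rewrite {1}(ksE _ inv Jt) lee_fin in up.
apply: le_trans up _; apply: le_trans (lerD (entropy_rate_le (mu_t t) cms_shift
  measurable_cms_shift inv.2 (symbol_upto K) n mX) (lerD tail (lexx _))) _.
apply: le_trans (lerD (ltW ent) (lexx _)) _; rewrite -addrA lerD2l; lra.
Unshelve. all: by end_near. Qed.

Lemma zero_temperature_entropy :
  cms_ks_entropy mu_inf = ereal_sup [set cms_ks_entropy mu | mu in cms_Mmax M f] /\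
  (fun t : R => cms_ks_entropy (mu_t t)) @ +oo%R --> cms_ks_entropy mu_inf.
Proof.
split.
  apply/le_anti/andP; split.
    by apply: ereal_sup_ubound; exists mu_inf => //; exact: limit_maximizing.
  apply: ge_ereal_sup => _ [nu mnu <-].
  have [inv _] := mnu.
  have Jfin : (J nu < +oo)%E by rewrite maximizing_weight//; exact: limit_weight_fin.
  rewrite h_infE (ksE _ inv Jfin) lee_fin; apply/ler_addgt0Pr => e e0.
  have [t [t1 ht]] : exists t : R, 1 < t /\ h t <= h_inf + e.
    have := @filter_ex _ (pinfty_nbhs R) _ _ (filterI (nbhs_pinfty_gt (num_real (1 : R)))
      (equilibrium_entropy_upper _ e0)).
    by move=> [t []]; exists t.
  apply: le_trans ht; rewrite -lee_fin -ksE// -ksE//.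
  - exact: maximizing_entropy_le.
  - exact: equilibrium_invariant.
  - exact: equilibrium_weight_fin.
rewrite h_infE; apply/fine_cvgP; split.
  near=> t; have t1 : 1 < t by near: t; apply: nbhs_pinfty_gt; exact: num_real.
  exact: (cms_ks_entropy_fin_num M u w u_ge0 wu w_summable _
    (equilibrium_invariant _ t1) (equilibrium_weight_fin _ t1)).
apply/cvgrPdist_le => e e0; near=> t.
have t1 : 1 < t by near: t; apply: nbhs_pinfty_gt; exact: num_real.
have up : h t <= h_inf + e by near: t; exact: equilibrium_entropy_upper.
(* [mu_inf] is itself maximizing, so the bound on maximizing measures gives the lower half of the
   convergence. *)
have lo : h_inf <= h t.
  rewrite -lee_fin -h_infE -(ksE _ (equilibrium_invariant _ t1) (equilibrium_weight_fin _ t1)).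
  exact: maximizing_entropy_le limit_maximizing t1.
by rewrite /= distrC ger0_norm ?subr_ge0// lerBlDl.
Unshelve. all: by end_near. Qed.

End zero_temperature.

Theorem theorem3 (R : realType) (M : nat -> nat -> bool)
  (f : (nat -> nat) -> R)
  (mu_t : R -> probability cms_shiftSpace R) (mu_inf : probability cms_shiftSpace R) :
  cms_topologically_mixing M ->
  cms_summable M f ->
  cms_markov_potential M f ->
  (cms_V1 M f < +oo)%E ->
  (forall a : nat, (cms_gurevich_pressure M f a < +oo)%E) ->
  (forall t : R, 1 < t -> cms_equilibrium_state M (fun x => t * f x) (mu_t t)) ->
  cms_weak_cvg_pinfty mu_t mu_inf ->
  cms_ks_entropy mu_inf = ereal_sup [set cms_ks_entropy mu | mu in cms_Mmax M f] /\
  (fun t : R => cms_ks_entropy (mu_t t)) @ +oo%R --> cms_ks_entropy mu_inf.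
Proof.
move=> _ sf mf _ _ mu_eq mu_cvg.
have [C [u [w [u_ge0 wu fE ws]]]] := markov_summable_weights _ _ sf mf.
exact: (zero_temperature_entropy M f C u w u_ge0 wu fE ws).
Qed.
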